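(* Let $a\ge0$, $\gamma_1,\gamma_2\in\mathbb{N}_0$ and $f\in C^3_{\gamma_1,\gamma_2}(I)$. Then for every $(x,y)\in(0,\infty)\times(0,\infty)$, $$\lim_{n\to\infty}n\Big\{\Big(\frac{\partial}{\partial\omega}K_{n,n}^a(f;\omega,y)\Big)_{\omega=x}-\frac{\partial f}{\partial x}(x,y)\Big\}=\Big(-1+\frac{a}{(1+x)^2}\Big)f_x(x,y)+\Big(1+\frac{ax}{1+x}\Big)f_{xx}(x,y)+\Big(-y+\frac{ay}{1+y}+\frac12\Big)f_{xy}(x,y)+\frac{y}{2}(1+y)f_{xyy}(x,y)+\frac{x}{2}(1+x)f_{xxx}(x,y)$$ and $$\lim_{n\to\infty}n\Big\{\Big(\frac{\partial}{\partial\nu}K_{n,n}^a(f;x,\nu)\Big)_{\nu=y}-\frac{\partial f}{\partial y}(x,y)\Big\}=\Big(-1+\frac{a}{(1+y)^2}\Big)f_y(x,y)+\Big(1+\frac{ay}{1+y}\Big)f_{yy}(x,y)+\Big(-x+\frac{ax}{1+x}+\frac12\Big)f_{xy}(x,y)+\frac{x}{2}(1+x)f_{xxy}(x,y)+\frac{y}{2}(1+y)f_{yyy}(x,y).$$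
   Context: $I=[0,\infty)\times[0,\infty)$, $\mathbb{N}=\{1,2,\dots\}$, $\mathbb{N}_0=\mathbb{N}\cup\{0\}$; $a\ge0$ is a fixed real parameter; functions are real-valued; subscripts on $f$ denote partial derivatives. Operators: let $(n)_0=1$, $(n)_i=n(n+1)\cdots(n+i-1)$ for $i\ge1$, $P_k(n,a)=\sum_{i=0}^{k}\binom{k}{i}(n)_i a^{k-i}$, and $$W_{n,k}^a(x)=e^{-\frac{ax}{1+x}}\frac{P_k(n,a)}{k!}\frac{x^k}{(1+x)^{n+k}},\qquad x\ge0,$$ (with $x^0=1$). Put $W^a_{n_1,n_2,k_1,k_2}(x,y)=W^a_{n_1,k_1}(x)W^a_{n_2,k_2}(y)$ and $$K_{n_1,n_2}^a(f;x,y)=(n_1+1)(n_2+1)\sum_{k_1=0}^\infty\sum_{k_2=0}^\infty W^a_{n_1,n_2,k_1,k_2}(x,y)\int_{\frac{k_2}{n_2+1}}^{\frac{k_2+1}{n_2+1}}\int_{\frac{k_1}{n_1+1}}^{\frac{k_1+1}{n_1+1}}f(u,v)\,du\,dv ;$$ $K_{n,n}^a$ is the case $n_1=n_2=n$. Weights and spaces: $\omega_\gamma(x)=(1+x^\gamma)^{-1}$ for $\gamma\in\mathbb{N}_0$ (with $x^0=1$), $\omega_{\gamma_1,\gamma_2}(x,y)=\omega_{\gamma_1}(x)\omega_{\gamma_2}(y)$. $C_{\gamma_1,\gamma_2}(I)$ is the set of $f\in C(I)$ such that $\omega_{\gamma_1,\gamma_2}f$ is bounded and uniformly continuous on $I$.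 For $m\in\mathbb{N}$, $C^m_{\gamma_1,\gamma_2}(I)$ is the space of $f\in C_{\gamma_1,\gamma_2}(I)$ whose partial derivatives $\frac{\partial^k f}{\partial x^s\partial y^{k-s}}$, $s=0,1,\dots,k$, $k=1,\dots,m$, belong to $C_{\gamma_1,\gamma_2}(I)$. *)

(* Defs.v *)
(* Stdlib real numbers with Coquelicot. *)
From Stdlib Require Import Reals Arith Factorial.
From Coquelicot Require Import Coquelicot.
Open Scope R_scope.

Definition quadrant (p : R * R) : Prop := 0 <= fst p /\ 0 <= snd p.

Fixpoint rising (n i : nat) : nat :=
  match i with
  | O => 1
  | S j => rising n j * (n + j)
  end.

(* [Binomial.C] is the binomial coefficient; the unqualified [C] is Coquelicot's
   type of complex numbers. *)
Definition P_poly (k n : nat) (a : R) : R :=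
  sum_f_R0 (fun i => Binomial.C k i * INR (rising n i) * a ^ (k - i)) k.

Definition W (a : R) (n k : nat) (x : R) : R :=
  exp (- (a * x / (1 + x))) * (P_poly k n a / INR (fact k))
  * (x ^ k / (1 + x) ^ (n + k)).

Definition W2 (a : R) (n1 n2 k1 k2 : nat) (x y : R) : R :=
  W a n1 k1 x * W a n2 k2 y.

Definition K (a : R) (n1 n2 : nat) (f : R * R -> R) (x y : R) : R :=
  (INR n1 + 1) * (INR n2 + 1) *
  Series (fun k1 => Series (fun k2 =>
    W2 a n1 n2 k1 k2 x y *
    RInt (fun v =>
            RInt (fun u => f (u, v))
                 (INR k1 / (INR n1 + 1)) ((INR k1 + 1) / (INR n1 + 1)))
         (INR k2 / (INR n2 + 1)) ((INR k2 + 1) / (INR n2 + 1)))).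

Definition omega (g : nat) (x : R) : R := / (1 + x ^ g).

Definition omega2 (g1 g2 : nat) (p : R * R) : R :=
  omega g1 (fst p) * omega g2 (snd p).

Definition bounded_on (D : R * R -> Prop) (h : R * R -> R) : Prop :=
  exists M : R, forall p, D p -> Rabs (h p) <= M.

Definition unif_continuous_on (D : R * R -> Prop) (h : R * R -> R) : Prop :=
  forall eps : R, 0 < eps -> exists delta : R, 0 < delta /\
    forall p q, D p -> D q ->
      Rabs (fst p - fst q) < delta -> Rabs (snd p - snd q) < delta ->
      Rabs (h p - h q) < eps.

Definition C_weighted (g1 g2 : nat) (f : R * R -> R) : Prop :=
  continuous_on quadrant f /\
  bounded_on quadrant (fun p => omega2 g1 g2 p * f p) /\
  unif_continuous_on quadrant (fun p => omega2 g1 g2 p * f p).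

(* Derivative of a function defined on [0, +oo[: only increments staying in
   [0, +oo[ are used, so that it is the right derivative at 0 and the usual
   derivative at every x > 0. *)
Definition is_derive_nonneg (g : R -> R) (x l : R) : Prop :=
  filterlim (fun h => (g (x + h) - g x) / h)
            (within (fun h => 0 <= x + h) (locally' 0)) (locally l).

Definition ex_derive_nonneg (g : R -> R) (x : R) : Prop :=
  exists l : R, is_derive_nonneg g x l.

(* Meaningful only under [ex_derive_nonneg g x] (and 0 <= x), like [Derive]. *)
Definition Derive_nonneg (g : R -> R) (x : R) : R :=
  iota (fun l : R => is_derive_nonneg g x l).

Definition Dx (f : R * R -> R) : R * R -> R :=
  fun p => Derive_nonneg (fun t => f (t, snd p)) (fst p).

Definition Dy (f : R * R -> R) : R * R -> R :=
  fun p => Derive_nonneg (fun t => f (fst p, t)) (snd p).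

Definition ex_Dx (f : R * R -> R) : Prop :=
  forall p, quadrant p -> ex_derive_nonneg (fun t => f (t, snd p)) (fst p).

Definition ex_Dy (f : R * R -> R) : Prop :=
  forall p, quadrant p -> ex_derive_nonneg (fun t => f (fst p, t)) (snd p).

(* d^(s+j) f / dx^s dy^j, differentiating in y first. *)
Definition partial (s j : nat) (f : R * R -> R) : R * R -> R :=
  Nat.iter s Dx (Nat.iter j Dy f).

Definition ex_partial (s j : nat) (f : R * R -> R) : Prop :=
  (forall i, (i < j)%nat -> ex_Dy (Nat.iter i Dy f)) /\
  (forall i, (i < s)%nat -> ex_Dx (Nat.iter i Dx (Nat.iter j Dy f))).

Definition Cm_weighted (m g1 g2 : nat) (f : R * R -> R) : Prop :=
  C_weighted g1 g2 f /\
  forall k s : nat, (1 <= k <= m)%nat -> (s <= k)%nat ->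
    ex_partial s (k - s) f /\ C_weighted g1 g2 (partial s (k - s) f).

(* Main.v *)
Require Import Defs.
From Stdlib Require Import Reals Lra Lia Psatz Factorial.
From Coquelicot Require Import Coquelicot.
Open Scope R_scope.

(** For fixed [x], the weights [W a n k x], [k = 0, 1, 2, ...], form a probability law.
    Indeed, with [t = x / (1 + x)], the power series with coefficients [P_k(n, a) / k!] sums
    to [exp (a t) (1 - t)^(-n)] ([P_poly_series]): [k] is distributed as a Poisson variable
    plus a negative binomial one. Its mean is [m = n x + a t], and logarithmic
    differentiation gives [W' = W (k - m) / (x (1 + x))]. Consequently the [x]-derivative of
    the operator is once more an expectation, in which the averages of [f] over the cells
    are weighted by the score [(k - m) / (x (1 + x))] ([is_derive_expect]). Applied to the
    powers of [k], the same formula produces all moments recursively, so that those up to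
    order four are explicit ([central_moments]).

    Around [(x, y)], the function [f] is a Taylor polynomial of degree three up to
    [o(|u - x|^3 + |v - y|^3)] ([taylor_local]). On each monomial the expectation is a
    product of two one-variable moments, which are rational functions of [n]; their
    expansion to the order [1 / n] gives the right-hand sides ([score_taylor_limit]).

    The remainder is negligible by counting powers of [n]: [k - m] is of order [sqrt n] and
    [u - x] of order [1 / sqrt n], so that [n] times the score times the remainder is
    [n * sqrt n * o(n^(-3/2))]. To make this precise for a function that away from [(x, y)]
    is only known to grow polynomially, the tool is a bound, uniform in [n], on the
    expectation of [exp (|k - m| / sqrt n)] ([exp_dev_bounded]): it comes from the
    closed form of the generating function and dominates every power of the deviations
    ([cell_mean_remainder], [score_remainder_small]).

    The second limit is the first one for the transposed array of averages, because
    the two sums can be interchanged ([expect2_flip]). *)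

(** * The generating function of the weights *)

Lemma CV_radius_ge_1 (b : nat -> R) :
  (forall t, Rabs t < 1 -> ex_pseries b t) -> Rbar_le 1 (CV_radius b).
Proof.
  intros Hb.
  destruct (Rbar_le_lt_dec 1 (CV_radius b)) as [H | H]; [exact H | exfalso].
  pose proof (CV_radius_ge_0 b) as H0.
  destruct (CV_radius b) as [r | |] eqn:Hr; simpl in H, H0; try easy.
  assert (Ht : Rabs ((r + 1) / 2) = (r + 1) / 2) by (apply Rabs_pos_eq; lra).
  apply (CV_disk_outside b ((r + 1) / 2)).
  - rewrite Hr, Ht. simpl. lra.
  - apply (ex_series_lim_0 (fun k => b k * ((r + 1) / 2) ^ k)).
    apply ex_pseries_R, Hb. rewrite Ht. lra.
Qed.

Lemma rising_shift (n k : nat) :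
  rising n (S k) = (n * rising (S n) k)%nat.
Proof.
  induction k as [|k IH]; [simpl; lia|].
  change (rising n (S (S k))) with (rising n (S k) * (n + S k))%nat.
  rewrite IH. simpl. nia.
Qed.

(** The coefficient identity behind [(1 - t)^(-n-1) = (1 - t)^(-n) / (1 - t)]. *)
Lemma sum_rising (n k : nat) :
  sum_f_R0 (fun i => INR (rising n i) / INR (fact i)) k
  = INR (rising (S n) k) / INR (fact k).
Proof.
  induction k as [|k IH]; [simpl; lra|].
  rewrite tech5, IH, rising_shift.
  change (rising (S n) (S k)) with (rising (S n) k * (S n + k))%nat.
  change (fact (S k)) with (S k * fact k)%nat.
  rewrite !mult_INR, plus_INR, !S_INR.
  pose proof (INR_fact_neq_0 k). pose proof (pos_INR k).
  field. split; lra.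
Qed.

(** Induction on [n], multiplying by the geometric series at each step. *)
Lemma negative_binomial_series (n : nat) (t : R) :
  Rabs t < 1 ->
  is_pseries (fun i => INR (rising n i) / INR (fact i)) t (/ (1 - t) ^ n).
Proof.
  revert t. induction n as [|n IH]; intros t Ht.
  - rewrite is_pseries_R. simpl pow. rewrite Rinv_1.
    apply is_series_ext with (fun k => match k with O => 1 | S _ => 0 end).
    + intros [|k]; [simpl; field|].
      rewrite rising_shift. simpl. unfold Rdiv. rewrite !Rmult_0_l. reflexivity.
    + apply is_series_decr_1.
      match goal with |- is_series _ ?l => replace l with 0 end.
      * apply filterlim_ext with (fun _ => 0); [|apply filterlim_const].
        intros k. rewrite sum_n_const. symmetry. apply Rmult_0_r.
      * unfold plus, opp; simpl. ring.
  - assert (Hgeo : forall s, Rabs s < 1 -> is_pseries (fun _ => 1) s (/ (1 - s))).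
    { intros s Hs. rewrite is_pseries_R.
      apply is_series_ext with (fun k => s ^ k); [intros; simpl; ring|].
      now apply is_series_geom. }
    assert (Hr : forall b, (forall s, Rabs s < 1 -> ex_pseries b s) ->
              Rbar_lt (Rabs t) (CV_radius b)).
    { intros b Hb. apply Rbar_lt_le_trans with 1; [exact Ht|].
      now apply CV_radius_ge_1. }
    assert (Hp := is_pseries_mult _ _ t _ _ (IH t Ht) (Hgeo t Ht)
             (Hr _ (fun s Hs => ex_intro _ _ (IH s Hs)))
             (Hr _ (fun s Hs => ex_intro _ _ (Hgeo s Hs)))).
    replace (/ (1 - t) ^ S n) with (/ (1 - t) ^ n * / (1 - t)).
    + revert Hp. apply is_pseries_ext. intros k. unfold PS_mult.
      rewrite <- sum_rising. apply sum_eq. intros; apply Rmult_1_r.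
    + apply Rabs_lt_between in Ht. simpl. rewrite Rinv_mult. ring.
Qed.

(** [P_poly k n a / k!] is the Cauchy product of the coefficients of
    [(1 - t)^(-n)] and of [exp (a t)]. *)
Lemma P_poly_series (a : R) (n : nat) (t : R) :
  Rabs t < 1 ->
  is_pseries (fun k => P_poly k n a / INR (fact k)) t
             (exp (a * t) * / (1 - t) ^ n).
Proof.
  intros Ht.
  assert (Hexp : forall s, is_pseries (fun k => a ^ k / INR (fact k)) s (exp (a * s))).
  { intros s. rewrite is_pseries_R.
    generalize (is_exp_Reals (a * s)). rewrite is_pseries_R.
    apply is_series_ext. intros k. rewrite Rpow_mult_distr. unfold Rdiv.
    change (/ INR (fact k) * (a ^ k * s ^ k) = a ^ k * / INR (fact k) * s ^ k). ring. }
  assert (Hr : forall b, (forall s, Rabs s < 1 -> ex_pseries b s) ->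
            Rbar_lt (Rabs t) (CV_radius b)).
  { intros b Hb. apply Rbar_lt_le_trans with 1; [exact Ht|].
    now apply CV_radius_ge_1. }
  assert (Hp := is_pseries_mult _ _ t _ _ (negative_binomial_series n t Ht) (Hexp t)
     (Hr _ (fun s Hs => ex_intro _ _ (negative_binomial_series n s Hs)))
     (Hr _ (fun s _ => ex_intro _ _ (Hexp s)))).
  rewrite Rmult_comm. revert Hp. apply is_pseries_ext. intros k.
  change (sum_f_R0 (fun i => INR (rising n i) / INR (fact i)
                             * (a ^ (k - i) / INR (fact (k - i)))) k
          = P_poly k n a * / INR (fact k)).
  unfold P_poly. rewrite Rmult_comm, scal_sum. apply sum_eq. intros i Hi.
  unfold Binomial.C.
  pose proof (INR_fact_neq_0 k). pose proof (INR_fact_neq_0 i).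
  pose proof (INR_fact_neq_0 (k - i)). field. auto.
Qed.

(** * Expectations under the weights *)

Lemma exp_mono (u v : R) : u <= v -> exp u <= exp v.
Proof. intros [H | ->]; [left; now apply exp_increasing | apply Rle_refl]. Qed.

(** Growth slower than every exponential. A fixed exponential rate would not be stable
    under products, and would not be summable against [W a n k x] for large [x]. *)
Definition subexp (b : nat -> R) : Prop :=
  forall l, 0 < l -> exists C, forall k, Rabs (b k) <= C * exp (l * INR k).

Lemma subexp_le (b c : nat -> R) :
  (forall k, Rabs (b k) <= Rabs (c k)) -> subexp c -> subexp b.
Proof.
  intros H Hc l Hl. destruct (Hc l Hl) as [C HC]. exists C. intros k.
  eapply Rle_trans; [apply H | apply HC].
Qed.

Lemma subexp_ext (b c : nat -> R) :
  (forall k, b k = c k) -> subexp b -> subexp c.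
Proof.
  intros H. apply subexp_le. intros k. rewrite H. apply Rle_refl.
Qed.

Lemma subexp_abs (b : nat -> R) : subexp b -> subexp (fun k => Rabs (b k)).
Proof. apply subexp_le. intros k. rewrite Rabs_Rabsolu. apply Rle_refl. Qed.

Lemma subexp_const (c : R) : subexp (fun _ => c).
Proof.
  intros l Hl. exists (Rabs c). intros k.
  rewrite <- (Rmult_1_r (Rabs c)) at 1.
  apply Rmult_le_compat_l; [apply Rabs_pos|].
  rewrite <- exp_0. apply exp_mono. pose proof (pos_INR k). nra.
Qed.

Lemma subexp_INR : subexp INR.
Proof.
  intros l Hl. exists (/ l). intros k. pose proof (pos_INR k).
  rewrite Rabs_pos_eq by assumption.
  apply Rmult_le_reg_l with l; [assumption|].
  rewrite <- Rmult_assoc, Rinv_r, Rmult_1_l by lra.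
  pose proof (exp_ineq1_le (l * INR k)). lra.
Qed.

Lemma subexp_plus (b c : nat -> R) :
  subexp b -> subexp c -> subexp (fun k => b k + c k).
Proof.
  intros Hb Hc l Hl. destruct (Hb l Hl) as [B HB]. destruct (Hc l Hl) as [D HD].
  exists (B + D). intros k. rewrite Rmult_plus_distr_r.
  eapply Rle_trans; [apply Rabs_triang|].
  apply Rplus_le_compat; auto.
Qed.

Lemma subexp_mult (b c : nat -> R) :
  subexp b -> subexp c -> subexp (fun k => b k * c k).
Proof.
  intros Hb Hc l Hl.
  destruct (Hb (l / 2)) as [B HB]; [lra|]. destruct (Hc (l / 2)) as [D HD]; [lra|].
  exists (B * D). intros k. rewrite Rabs_mult.
  replace (l * INR k) with (l / 2 * INR k + l / 2 * INR k) by field.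
  rewrite exp_plus.
  replace (B * D * (exp (l / 2 * INR k) * exp (l / 2 * INR k)))
    with ((B * exp (l / 2 * INR k)) * (D * exp (l / 2 * INR k))) by ring.
  apply Rmult_le_compat; auto using Rabs_pos.
Qed.

Lemma subexp_scal (c : R) (b : nat -> R) : subexp b -> subexp (fun k => c * b k).
Proof. intros Hb. apply subexp_mult; [apply subexp_const | exact Hb]. Qed.

Lemma subexp_minus (b c : nat -> R) :
  subexp b -> subexp c -> subexp (fun k => b k - c k).
Proof.
  intros Hb Hc. apply (subexp_ext (fun k => b k + (-1) * c k)).
  - intros; ring.
  - now apply subexp_plus, subexp_scal.
Qed.

Lemma subexp_pow (b : nat -> R) (r : nat) : subexp b -> subexp (fun k => b k ^ r).
Proof.
  intros Hb. induction r as [|r IH]; simpl.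
  - apply subexp_const.
  - now apply subexp_mult.
Qed.

#[local] Hint Resolve subexp_const subexp_INR subexp_plus subexp_mult subexp_minus
  subexp_scal subexp_pow subexp_abs : subexp.

Lemma exp_INR (l : R) (k : nat) : exp (l * INR k) = exp l ^ k.
Proof.
  induction k as [|k IH]; [simpl; rewrite Rmult_0_r; apply exp_0|].
  rewrite S_INR, Rmult_plus_distr_l, exp_plus, IH, Rmult_1_r. simpl. ring.
Qed.

Definition coef (a : R) (n k : nat) : R := P_poly k n a / INR (fact k).

Lemma P_poly_nonneg (a : R) (k n : nat) : 0 <= a -> 0 <= P_poly k n a.
Proof.
  intros Ha. apply cond_pos_sum. intros i.
  apply Rmult_le_pos; [apply Rmult_le_pos|now apply pow_le].
  - unfold Binomial.C, Rdiv. apply Rmult_le_pos; [apply pos_INR|].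
    left. apply Rinv_0_lt_compat, Rmult_lt_0_compat; apply INR_fact_lt_0.
  - apply pos_INR.
Qed.

Lemma coef_nonneg (a : R) (n k : nat) : 0 <= a -> 0 <= coef a n k.
Proof.
  intros Ha. apply Rdiv_le_0_compat; [now apply P_poly_nonneg|apply INR_fact_lt_0].
Qed.

(** The slack in [subexp] lets [t^k] absorb the growth of [b] at every [t] inside the
    unit disk. *)
Lemma ex_pseries_coef (a : R) (n : nat) (b : nat -> R) (t : R) :
  0 <= a -> subexp b -> Rabs t < 1 -> ex_pseries (fun k => coef a n k * b k) t.
Proof.
  intros Ha Hb Ht. pose proof (Rabs_pos t) as Ht0.
  set (l := ln (2 / (1 + Rabs t))).
  assert (He : exp l = 2 / (1 + Rabs t)).
  { apply exp_ln. apply Rdiv_lt_0_compat; lra. }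
  assert (Hl : 0 < l).
  { unfold l. rewrite <- ln_1. apply ln_increasing; [lra|].
    apply Rmult_lt_reg_r with (1 + Rabs t); [lra|].
    unfold Rdiv. rewrite Rmult_assoc, Rinv_l; lra. }
  assert (Hs : 0 <= exp l * Rabs t < 1).
  { split; [apply Rmult_le_pos; [left; apply exp_pos | assumption]|].
    rewrite He. apply Rmult_lt_reg_r with (1 + Rabs t); [lra|].
    replace (2 / (1 + Rabs t) * Rabs t * (1 + Rabs t)) with (2 * Rabs t) by (field; lra).
    lra. }
  destruct (Hb l Hl) as [C HC].
  apply ex_pseries_R.
  apply (@ex_series_le R_AbsRing R_CompleteNormedModule) with
    (fun k => C * (coef a n k * (exp l * Rabs t) ^ k)).
  - intros k. unfold norm; simpl. unfold abs; simpl.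
    rewrite !Rabs_mult, (Rabs_pos_eq (coef a n k)) by now apply coef_nonneg.
    rewrite Rpow_mult_distr, <- exp_INR, <- RPow_abs.
    replace (C * (coef a n k * (exp (l * INR k) * Rabs t ^ k)))
      with (coef a n k * (C * exp (l * INR k)) * Rabs t ^ k) by ring.
    apply Rmult_le_compat_r; [apply pow_le, Rabs_pos|].
    apply Rmult_le_compat_l; [now apply coef_nonneg | apply HC].
  - apply (ex_series_scal (K := R_AbsRing) (V := R_NormedModule) C).
    apply ex_pseries_R. eexists. apply P_poly_series.
    rewrite Rabs_pos_eq; lra.
Qed.

Lemma frac_bounds (x : R) : 0 <= x -> 0 <= x / (1 + x) < 1.
Proof.
  intros Hx. split; [apply Rdiv_le_0_compat; lra|].
  apply Rmult_lt_reg_r with (1 + x); [lra|].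
  unfold Rdiv. rewrite Rmult_assoc, Rinv_l; lra.
Qed.

Lemma frac_abs (x : R) : 0 <= x -> Rabs (x / (1 + x)) < 1.
Proof. intros Hx. rewrite Rabs_pos_eq; now apply frac_bounds. Qed.

(** The factor of [W a n k x] that does not depend on [k]; the power [(1 + x)^(-n)] is
    put in the exponent so that the derivative has no exponent [n - 1]. *)
Definition prefactor (a : R) (n : nat) (x : R) : R :=
  exp (- (a * x / (1 + x)) - INR n * ln (1 + x)).

Lemma W_power (a : R) (n k : nat) (x : R) :
  0 <= x -> W a n k x = prefactor a n x * (coef a n k * (x / (1 + x)) ^ k).
Proof.
  intros Hx. unfold W, prefactor, coef, Rminus.
  rewrite exp_plus, (Rmult_comm (INR n)).
  rewrite (Ropp_mult_distr_l (ln (1 + x))), exp_INR, (exp_Ropp (ln (1 + x))).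
  rewrite exp_ln, pow_inv by lra. unfold Rdiv at 6. rewrite Rpow_mult_distr, pow_inv.
  rewrite pow_add. unfold Rdiv. rewrite Rinv_mult. ring.
Qed.

Lemma W_nonneg (a : R) (n k : nat) (x : R) : 0 <= a -> 0 <= x -> 0 <= W a n k x.
Proof.
  intros Ha Hx. rewrite W_power by assumption.
  apply Rmult_le_pos; [left; apply exp_pos|].
  apply Rmult_le_pos; [now apply coef_nonneg | now apply pow_le, frac_bounds].
Qed.

Definition expect (a : R) (n : nat) (x : R) (b : nat -> R) : R :=
  Series (fun k => W a n k x * b k).

Lemma ex_series_W (a : R) (n : nat) (x : R) (b : nat -> R) :
  0 <= a -> 0 <= x -> subexp b -> ex_series (fun k => W a n k x * b k).
Proof.
  intros Ha Hx Hb.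
  apply (ex_series_ext (fun k => prefactor a n x * (coef a n k * b k * (x / (1 + x)) ^ k))).
  - intros k. rewrite W_power by assumption. simpl; ring.
  - apply (ex_series_scal (K := R_AbsRing) (V := R_NormedModule) (prefactor a n x)).
    apply ex_pseries_R, ex_pseries_coef; auto using frac_abs.
Qed.

Lemma expect_power (a : R) (n : nat) (x : R) (b : nat -> R) :
  0 <= x ->
  expect a n x b
  = prefactor a n x * PSeries (fun k => coef a n k * b k) (x / (1 + x)).
Proof.
  intros Hx. unfold expect, PSeries. rewrite <- Series_scal_l.
  apply Series_ext. intros k. rewrite W_power by assumption. ring.
Qed.

Lemma expect_ext (a : R) (n : nat) (x : R) (b c : nat -> R) :
  (forall k, b k = c k) -> expect a n x b = expect a n x c.
Proof. intros H. apply Series_ext. intros k. now rewrite H. Qed.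

Lemma expect_scal (a : R) (n : nat) (x c : R) (b : nat -> R) :
  expect a n x (fun k => c * b k) = c * expect a n x b.
Proof.
  unfold expect. rewrite <- Series_scal_l. apply Series_ext. intros; ring.
Qed.

Lemma expect_plus (a : R) (n : nat) (x : R) (b c : nat -> R) :
  0 <= a -> 0 <= x -> subexp b -> subexp c ->
  expect a n x (fun k => b k + c k) = expect a n x b + expect a n x c.
Proof.
  intros Ha Hx Hb Hc. unfold expect.
  rewrite <- Series_plus by now apply ex_series_W.
  apply Series_ext. intros; ring.
Qed.

Lemma expect_abs_le (a : R) (n : nat) (x : R) (b c : nat -> R) :
  0 <= a -> 0 <= x -> (forall k, Rabs (b k) <= c k) ->
  ex_series (fun k => W a n k x * c k) ->
  Rabs (expect a n x b) <= expect a n x c.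
Proof.
  intros Ha Hx Hbc Hc.
  assert (H : forall k, 0 <= Rabs (W a n k x * b k) <= W a n k x * c k).
  { intros k. split; [apply Rabs_pos|].
    rewrite Rabs_mult, (Rabs_pos_eq (W a n k x)) by now apply W_nonneg.
    apply Rmult_le_compat_l; [now apply W_nonneg | apply Hbc]. }
  eapply Rle_trans; [apply Series_Rabs | now apply Series_le].
  apply (@ex_series_le R_AbsRing R_CompleteNormedModule) with (2 := Hc).
  intros k. unfold norm; simpl. unfold abs; simpl. rewrite Rabs_Rabsolu. apply H.
Qed.

Lemma expect_one (a : R) (n : nat) (x : R) : 0 <= x -> expect a n x (fun _ => 1) = 1.
Proof.
  intros Hx. rewrite expect_power by assumption.
  rewrite (PSeries_ext _ (coef a n)) by (intros; ring).
  rewrite (is_pseries_unique (coef a n) _ _ (P_poly_series a n _ (frac_abs x Hx))).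
  replace (1 - x / (1 + x)) with (/ (1 + x)) by (field; lra).
  unfold prefactor, Rminus.
  rewrite pow_inv, Rinv_inv, exp_plus, (Rmult_comm (INR n)).
  rewrite (Ropp_mult_distr_l (ln (1 + x))).
  rewrite exp_INR, !exp_Ropp, exp_ln, pow_inv by lra.
  replace (a * (x / (1 + x))) with (a * x / (1 + x)) by (field; lra).
  field. split; [apply pow_nonzero; lra | apply Rgt_not_eq, exp_pos].
Qed.

(** * Differentiation under the sum *)

Definition mean (a : R) (n : nat) (x : R) : R := INR n * x + a * x / (1 + x).

(** The logarithmic derivative in [x] of [W a n k x]. *)
Definition score (a : R) (n : nat) (x : R) (k : nat) : R :=
  (INR k - mean a n x) / (x * (1 + x)).

Lemma subexp_score (a : R) (n : nat) (x : R) : subexp (score a n x).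
Proof. unfold score, Rdiv. auto with subexp. Qed.

(** The sum is [prefactor] times a power series in [t = x / (1 + x)], which can be
    differentiated inside its disk of convergence; as [dt/dx = 1 / (1 + x)^2], the operator
    [t d/dt] that multiplies the [k]-th term by [k] comes with the factor
    [1 / (x (1 + x))]. *)
Lemma is_derive_expect (a : R) (n : nat) (x : R) (b : nat -> R) :
  0 <= a -> 0 < x -> subexp b ->
  is_derive (fun w : R => expect a n w b) x (expect a n x (fun k => score a n x k * b k)).
Proof.
  intros Ha Hx Hb.
  set (u := fun k => coef a n k * b k).
  set (t := x / (1 + x)).
  assert (Hr : Rbar_lt (Rabs t) (CV_radius u)).
  { apply Rbar_lt_le_trans with 1; [apply frac_abs; lra|].
    apply CV_radius_ge_1. intros s Hs. now apply ex_pseries_coef. }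
  apply (is_derive_ext_loc (fun w => prefactor a n w * PSeries u (w / (1 + w)))).
  { exists (mkposreal x Hx). intros w Hw. symmetry. apply expect_power.
    change (Rabs (w - x) < x) in Hw. apply Rabs_lt_between in Hw. lra. }
  assert (HA : is_derive (prefactor a n) x
                 (- (mean a n x / (x * (1 + x))) * prefactor a n x)).
  { unfold prefactor, mean. auto_derive; [lra|]. unfold Rminus, Rdiv. field. lra. }
  assert (HB : is_derive (fun w => PSeries u (w / (1 + w))) x
                 (/ (1 + x) ^ 2 * PSeries (PS_derive u) t)).
  { apply (is_derive_comp (PSeries u) (fun w => w / (1 + w))).
    - now apply is_derive_PSeries.
    - auto_derive; [lra|]. field. lra. }
  evar_last.
  { apply (is_derive_mult _ _ _ _ _ HA HB). intros; apply Rmult_comm. }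
  unfold plus, mult; simpl.
  (* Euler's operator t d/dt brings down the factor k. *)
  assert (Hk : PSeries (fun k => INR k * u k) t = t * PSeries (PS_derive u) t).
  { rewrite <- PSeries_incr_1. apply PSeries_ext. intros [|k]; simpl; [|reflexivity].
    rewrite Rmult_0_l. reflexivity. }
  rewrite (expect_ext _ _ _ _
             (fun k => / (x * (1 + x)) * (INR k * b k + - mean a n x * b k)))
    by (intros k; unfold score, Rdiv; ring).
  rewrite expect_scal, expect_plus, expect_scal by (lra || auto with subexp).
  rewrite !expect_power by lra. fold u t.
  rewrite (PSeries_ext (fun k => coef a n k * (INR k * b k)) (fun k => INR k * u k))
    by (intros k; unfold u; ring).
  rewrite Hk. unfold t. field. lra.
Qed.

(** * Central moments *)

(** Since [score] is affine in [k], the derivative of an expectation known in closed form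
    yields the next moment: each [E k^(r+1)] follows from [E k^r] by differentiation. *)
Lemma moment_step (a : R) (n : nat) (x : R) (b : nat -> R) (g : R -> R) (dg : R) :
  0 <= a -> 0 < x -> subexp b -> (forall w, 0 < w -> expect a n w b = g w) ->
  is_derive g x dg ->
  expect a n x (fun k => INR k * b k) = x * (1 + x) * dg + mean a n x * g x.
Proof.
  intros Ha Hx Hb Hg Hdg.
  assert (H : is_derive g x (expect a n x (fun k => score a n x k * b k))).
  { apply (is_derive_ext_loc (fun w => expect a n w b)); [|now apply is_derive_expect].
    exists (mkposreal x Hx). intros w Hw. apply Hg.
    change (Rabs (w - x) < x) in Hw. apply Rabs_lt_between in Hw. lra. }
  apply is_derive_unique in H. apply is_derive_unique in Hdg.
  rewrite <- Hdg, H, <- Hg, <- !expect_scal, <- expect_plus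
    by (lra || auto using subexp_score with subexp).
  apply expect_ext. intros k. unfold score. field. lra.
Qed.

(** The law [W] is that of a Poisson variable of parameter [a x / (1 + x)], all of whose
    cumulants equal this parameter, plus an independent sum of [n] geometric variables of
    mean [x], whose cumulants are the polynomials below. *)
Definition cumulant2 (a : R) (n : nat) (x : R) : R :=
  INR n * (x * (1 + x)) + a * x / (1 + x).
Definition cumulant3 (a : R) (n : nat) (x : R) : R :=
  INR n * (x * (1 + x) * (1 + 2 * x)) + a * x / (1 + x).
Definition cumulant4 (a : R) (n : nat) (x : R) : R :=
  INR n * (x * (1 + x) * (1 + 6 * x + 6 * x ^ 2)) + a * x / (1 + x).

Lemma raw_moments (a : R) (n : nat) (x : R) :
  0 <= a -> 0 < x ->
  let m := mean a n x in
  let c2 := cumulant2 a n x in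
  let c3 := cumulant3 a n x in
  let c4 := cumulant4 a n x in
  expect a n x (fun k => INR k) = m /\
  expect a n x (fun k => INR k ^ 2) = m ^ 2 + c2 /\
  expect a n x (fun k => INR k ^ 3) = m ^ 3 + 3 * m * c2 + c3 /\
  expect a n x (fun k => INR k ^ 4)
  = m ^ 4 + 6 * m ^ 2 * c2 + 4 * m * c3 + 3 * c2 ^ 2 + c4.
Proof.
  intros Ha Hx. cbv zeta.
  assert (H1 : forall w, 0 < w -> expect a n w (fun k => INR k) = mean a n w).
  { intros w Hw. rewrite (expect_ext _ _ _ _ (fun k => INR k * 1)) by (intros; ring).
    rewrite (moment_step a n w (fun _ => 1) (fun _ => 1) 0); auto with subexp; try ring.
    - intros v Hv. apply expect_one. lra.
    - auto_derive; auto. }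
  assert (H2 : forall w, 0 < w ->
            expect a n w (fun k => INR k ^ 2) = mean a n w ^ 2 + cumulant2 a n w).
  { intros w Hw. rewrite (expect_ext _ _ _ _ (fun k => INR k * INR k)) by (intros; ring).
    erewrite moment_step; [| | | |exact H1|]; auto with subexp.
    2: unfold mean; auto_derive; [lra|reflexivity].
    unfold cumulant2, mean. field. lra. }
  assert (H3 : forall w, 0 < w ->
            expect a n w (fun k => INR k ^ 3)
            = mean a n w ^ 3 + 3 * mean a n w * cumulant2 a n w + cumulant3 a n w).
  { intros w Hw. rewrite (expect_ext _ _ _ _ (fun k => INR k * INR k ^ 2)) by (intros; ring).
    erewrite moment_step; [| | | |exact H2|]; auto with subexp.
    2: unfold mean, cumulant2; auto_derive; [lra|reflexivity].
    unfold cumulant3, cumulant2, mean. field. lra. }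
  repeat split; auto.
  rewrite (expect_ext _ _ _ _ (fun k => INR k * INR k ^ 3)) by (intros; ring).
  erewrite moment_step; [| | | |exact H3|]; auto with subexp.
  2: unfold mean, cumulant2, cumulant3; auto_derive; [lra|reflexivity].
  unfold cumulant4, cumulant3, cumulant2, mean. field. lra.
Qed.

Lemma central_moments (a : R) (n : nat) (x : R) :
  0 <= a -> 0 < x ->
  let d := fun k => INR k - mean a n x in
  expect a n x d = 0 /\
  expect a n x (fun k => d k ^ 2) = cumulant2 a n x /\
  expect a n x (fun k => d k ^ 3) = cumulant3 a n x /\
  expect a n x (fun k => d k ^ 4) = 3 * cumulant2 a n x ^ 2 + cumulant4 a n x.
Proof.
  intros Ha Hx. cbv zeta.
  destruct (raw_moments a n x Ha Hx) as (H1 & H2 & H3 & H4).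
  set (m := mean a n x) in *.
  assert (H : forall c0 c1 c2 c3 c4,
     expect a n x (fun k => c4 * INR k ^ 4 + (c3 * INR k ^ 3 + (c2 * INR k ^ 2
                            + (c1 * INR k + c0 * 1))))
     = c4 * expect a n x (fun k => INR k ^ 4) + (c3 * expect a n x (fun k => INR k ^ 3)
       + (c2 * expect a n x (fun k => INR k ^ 2) + (c1 * expect a n x (fun k => INR k)
       + c0 * expect a n x (fun _ => 1))))).
  { intros. rewrite !expect_plus, !expect_scal by (lra || auto 10 with subexp).
    reflexivity. }
  rewrite expect_one, H1, H2, H3, H4 in H by lra.
  repeat split.
  - specialize (H (- m) 1 0 0 0). erewrite expect_ext; [rewrite H; ring|].
    intros; simpl; ring.
  - specialize (H (m ^ 2) (- 2 * m) 1 0 0). erewrite expect_ext; [rewrite H; ring|].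
    intros; simpl; ring.
  - specialize (H (- m ^ 3) (3 * m ^ 2) (- 3 * m) 1 0).
    erewrite expect_ext; [rewrite H; ring|]. intros; simpl; ring.
  - specialize (H (m ^ 4) (- 4 * m ^ 3) (6 * m ^ 2) (- 4 * m) 1).
    erewrite expect_ext; [rewrite H; ring|]. intros; simpl; ring.
Qed.

(** * Exponential moments at scale sqrt n *)

Lemma exp_quadratic_upper (l : R) : Rabs l <= 1 / 2 -> exp l <= 1 + l + 2 * l ^ 2.
Proof.
  intros Hl. apply Rabs_le_between in Hl.
  pose proof (exp_ineq1_le (- l)) as H. rewrite exp_Ropp in H.
  pose proof (exp_pos l) as He.
  assert (H1 : (1 - l) * exp l <= 1).
  { apply Rmult_le_compat_r with (r := exp l) in H; [|lra].
    rewrite Rinv_l in H; lra. }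
  apply Rmult_le_reg_l with (1 - l); [lra|]. nra.
Qed.

Lemma inv_one_minus_upper (z : R) : Rabs z <= 1 / 2 -> / (1 - z) <= exp (z + 2 * z ^ 2).
Proof.
  intros Hz. apply Rabs_le_between in Hz.
  apply Rle_trans with (1 + (z + 2 * z ^ 2)); [|apply exp_ineq1_le].
  apply Rmult_le_reg_l with (1 - z); [lra|]. rewrite Rinv_r by lra. nra.
Qed.

Lemma W_exp_series (a : R) (n : nat) (x l : R) :
  0 <= x -> x / (1 + x) * exp l < 1 ->
  is_series (fun k => W a n k x * exp (l * (INR k - mean a n x)))
    (prefactor a n x * exp (- (l * mean a n x)) *
     (exp (a * (x / (1 + x) * exp l)) * / (1 - x / (1 + x) * exp l) ^ n)).
Proof.
  intros Hx Hl.
  pose proof (proj1 (frac_bounds x Hx)) as Ht.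
  assert (Hs : Rabs (x / (1 + x) * exp l) < 1).
  { rewrite Rabs_pos_eq; [exact Hl|]. apply Rmult_le_pos; [exact Ht|].
    left; apply exp_pos. }
  generalize (P_poly_series a n _ Hs). rewrite is_pseries_R. intros H.
  apply (is_series_scal (K := R_AbsRing) (V := R_NormedModule)
           (prefactor a n x * exp (- (l * mean a n x)))) in H.
  revert H. apply is_series_ext. intros k.
  rewrite W_power by assumption. unfold scal; simpl; unfold mult; simpl.
  replace (l * (INR k - mean a n x)) with (- (l * mean a n x) + l * INR k) by ring.
  rewrite exp_plus, exp_INR, Rpow_mult_distr. unfold coef. ring.
Qed.

(** The logarithm of the expectation vanishes to second order at [l = 0], because [mean]
    is the mean; [l] of size [1 / sqrt n] thus gives a bound free of [n]. *)
Lemma exp_moment_upper (a : R) (n : nat) (x l : R) :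
  0 <= a -> 0 < x -> Rabs l <= 1 / 2 -> 4 * x * Rabs l <= 1 ->
  ex_series (fun k => W a n k x * exp (l * (INR k - mean a n x))) /\
  expect a n x (fun k => exp (l * (INR k - mean a n x)))
  <= exp ((2 * a + INR n * (2 * x + 8 * x ^ 2)) * l ^ 2).
Proof.
  intros Ha Hx Hl Hxl.
  pose proof (exp_quadratic_upper l Hl) as Hup. pose proof (exp_ineq1_le l) as Hlo.
  pose proof (frac_bounds x (Rlt_le _ _ Hx)) as Ht.
  set (z := x * (exp l - 1)).
  assert (Hz2 : Rabs (exp l - 1) <= 2 * Rabs l).
  { apply Rabs_le_between in Hl. unfold Rabs in *.
    destruct (Rcase_abs l); destruct (Rcase_abs (exp l - 1)); nra. }
  assert (Hz : Rabs z <= 2 * x * Rabs l).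
  { unfold z. rewrite Rabs_mult, (Rabs_pos_eq x) by lra. nra. }
  assert (Hz12 : Rabs z <= 1 / 2) by lra.
  assert (Hsq : z ^ 2 <= 4 * x ^ 2 * l ^ 2).
  { rewrite <- (pow2_abs z), <- (pow2_abs l). pose proof (Rabs_pos z). nra. }
  assert (H1z : 1 - x / (1 + x) * exp l = (1 - z) / (1 + x)).
  { unfold z. field. lra. }
  assert (Hz1 : z <= 1 / 2) by (apply Rabs_le_between in Hz12; lra).
  assert (Hlt : x / (1 + x) * exp l < 1).
  { assert (0 < (1 - z) / (1 + x)) by (apply Rdiv_lt_0_compat; lra). lra. }
  pose proof (W_exp_series a n x l (Rlt_le _ _ Hx) Hlt) as Hser.
  split; [eexists; exact Hser|].
  unfold expect. rewrite (is_series_unique _ _ Hser), H1z.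
  apply Rle_trans with
    (exp (a * (x / (1 + x)) * (exp l - 1 - l) + INR n * (z + 2 * z ^ 2 - x * l))).
  - replace (a * (x / (1 + x)) * (exp l - 1 - l) + INR n * (z + 2 * z ^ 2 - x * l))
      with (- (a * x / (1 + x)) + - (l * mean a n x)
            + a * (x / (1 + x) * exp l) + (z + 2 * z ^ 2) * INR n)
      by (unfold mean; field; lra).
    rewrite !exp_plus. unfold prefactor, Rminus at 1.
    rewrite exp_plus, (Rmult_comm (INR n)), (Ropp_mult_distr_l (ln (1 + x))).
    rewrite !exp_INR, (exp_Ropp (ln (1 + x))), exp_ln by lra.
    rewrite <- !pow_inv.
    replace ((/ ((1 - z) / (1 + x))) ^ n) with ((1 + x) ^ n * (/ (1 - z)) ^ n).
    2:{ rewrite <- Rpow_mult_distr. f_equal. field. lra. }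
    match goal with |- ?L <= _ =>
      replace L with (exp (- (a * x / (1 + x))) * exp (- (l * mean a n x)) *
        exp (a * (x / (1 + x) * exp l)) * (/ (1 - z)) ^ n) end.
    + apply Rmult_le_compat_l.
      * repeat apply Rmult_le_pos; left; apply exp_pos.
      * apply pow_incr. split; [left; apply Rinv_0_lt_compat; lra|].
        now apply inv_one_minus_upper.
    + rewrite (pow_inv (1 + x)). field. apply pow_nonzero; lra.
  - apply exp_mono. rewrite Rmult_plus_distr_r.
    apply Rplus_le_compat.
    + pose proof (pow2_ge_0 l).
      apply Rle_trans with (a * 1 * (2 * l ^ 2)); [|lra].
      apply Rmult_le_compat; try nra.
    + rewrite Rmult_assoc. apply Rmult_le_compat_l; [apply pos_INR|].
      unfold z in *. nra.
Qed.

(** Measured in units of [sqrt n], the order of the standard deviation. *)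
Definition dev (a : R) (n : nat) (x : R) (k : nat) : R :=
  Rabs (INR k - mean a n x) / sqrt (INR n).

Lemma dev_nonneg (a : R) (n : nat) (x : R) (k : nat) :
  (1 <= n)%nat -> 0 <= dev a n x k.
Proof.
  intros Hn. apply Rdiv_le_0_compat; [apply Rabs_pos|].
  apply sqrt_lt_R0, lt_0_INR. lia.
Qed.

(** The choice [l = 1 / sqrt n] and [l = - 1 / sqrt n] in [exp_moment_upper] bounds the
    exponential of either sign, hence that of the absolute value. This one estimate
    controls all moments of [dev] uniformly in [n]. *)
Lemma exp_dev_bounded (a x : R) :
  0 <= a -> 0 < x ->
  exists B N, 0 < B /\ forall n, (N <= n)%nat -> (1 <= n)%nat ->
    ex_series (fun k => W a n k x * exp (dev a n x k)) /\
    expect a n x (fun k => exp (dev a n x k)) <= B.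
Proof.
  intros Ha Hx.
  (* These thresholds are what [Rabs l <= 1 / 2] and [4 * x * Rabs l <= 1] require. *)
  destruct (nfloor_ex (Rmax 4 (16 * x ^ 2))) as [N [_ HN]].
  { apply Rle_trans with 4; [lra | apply Rmax_l]. }
  exists (2 * exp (2 * a + (2 * x + 8 * x ^ 2))), (S N).
  split; [pose proof (exp_pos (2 * a + (2 * x + 8 * x ^ 2))); lra|].
  intros n Hn Hn1. apply le_INR in Hn, Hn1. rewrite S_INR in Hn. simpl in Hn1.
  pose proof (Rmax_l 4 (16 * x ^ 2)). pose proof (Rmax_r 4 (16 * x ^ 2)).
  assert (Hs : 0 < sqrt (INR n)) by (apply sqrt_lt_R0; lra).
  set (l := / sqrt (INR n)).
  assert (Hl0 : 0 < l) by now apply Rinv_0_lt_compat.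
  assert (Hsq : sqrt (INR n) * sqrt (INR n) = INR n) by (apply sqrt_sqrt; lra).
  assert (Hl : l * sqrt (INR n) = 1) by (apply Rinv_l; lra).
  assert (Hl2 : INR n * l ^ 2 = 1) by (rewrite <- Hsq; nra).
  assert (Hle1 : l <= 1 / 2).
  { assert (2 <= sqrt (INR n)) by nra. nra. }
  assert (Hle2 : 4 * x * l <= 1).
  { assert (4 * x <= sqrt (INR n)) by nra. nra. }
  assert (Hside : forall s, Rabs s = l ->
    ex_series (fun k => W a n k x * exp (s * (INR k - mean a n x))) /\
    expect a n x (fun k => exp (s * (INR k - mean a n x)))
    <= exp (2 * a + (2 * x + 8 * x ^ 2))).
  { intros s Hsl. destruct (exp_moment_upper a n x s) as [E1 E2]; try lra; try nra.
    split; [exact E1|]. eapply Rle_trans; [exact E2|]. apply exp_mono.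
    rewrite <- (pow2_abs s), Hsl, Rmult_plus_distr_r.
    replace (INR n * (2 * x + 8 * x ^ 2) * l ^ 2)
      with (INR n * l ^ 2 * (2 * x + 8 * x ^ 2)) by ring.
    rewrite Hl2. assert (l ^ 2 <= 1) by nra. nra. }
  destruct (Hside l) as [E1 B1]; [apply Rabs_pos_eq; lra|].
  destruct (Hside (- l)) as [E2 B2]; [rewrite Rabs_Ropp; apply Rabs_pos_eq; lra|].
  assert (Hdom : forall k, Rabs (exp (dev a n x k)) <=
     exp (l * (INR k - mean a n x)) + exp (- l * (INR k - mean a n x))).
  { intros k. rewrite Rabs_pos_eq by (left; apply exp_pos).
    pose proof (exp_pos (l * (INR k - mean a n x))).
    pose proof (exp_pos (- l * (INR k - mean a n x))).
    unfold dev, Rdiv. fold l. unfold Rabs. destruct Rcase_abs.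
    - replace (- (INR k - mean a n x) * l) with (- l * (INR k - mean a n x)) by ring. lra.
    - rewrite Rmult_comm. lra. }
  pose proof (ex_series_plus _ _ E1 E2) as Esum.
  assert (Esum' : ex_series (fun k => W a n k x *
     (exp (l * (INR k - mean a n x)) + exp (- l * (INR k - mean a n x))))).
  { revert Esum. apply ex_series_ext. intros k. unfold plus; simpl. ring. }
  split.
  - apply (@ex_series_le R_AbsRing R_CompleteNormedModule) with (2 := Esum').
    intros k. unfold norm; simpl; unfold abs; simpl.
    rewrite Rabs_mult, (Rabs_pos_eq (W a n k x)) by (apply W_nonneg; lra).
    apply Rmult_le_compat_l; [apply W_nonneg; lra | apply Hdom].
  - eapply Rle_trans; [apply Rle_abs|].
    eapply Rle_trans; [apply expect_abs_le; [lra|lra|exact Hdom|exact Esum']|].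
    unfold expect in *.
    rewrite (Series_ext _ (fun k => W a n k x * exp (l * (INR k - mean a n x))
       + W a n k x * exp (- l * (INR k - mean a n x)))) by (intros; ring).
    rewrite Series_plus by assumption. lra.
Qed.

(** Half of the exponential budget of [exp_dev_bounded] pays for the polynomial factors;
    the other half remains for the score. *)
Lemma pow_le_exp_half (c : R) (p : nat) :
  0 <= c -> exists C, 0 < C /\ forall t, 0 <= t -> (1 + c + t) ^ p <= C * exp (t / 2).
Proof.
  intros Hc. destruct p as [|p].
  - exists 1. split; [lra|]. intros t Ht. simpl.
    pose proof (exp_ineq1_le (t / 2)). lra.
  - set (q := 2 * INR (S p)).
    assert (Hq : 2 <= q).
    { unfold q. rewrite S_INR. pose proof (pos_INR p). lra. }
    exists (((1 + c) * q) ^ S p). split; [apply pow_lt; nra|]. intros t Ht.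
    replace (t / 2) with (t / q * INR (S p)) by (unfold q; field; apply not_0_INR; lia).
    rewrite exp_INR, <- Rpow_mult_distr. apply pow_incr. split; [lra|].
    pose proof (exp_ineq1_le (t / q)) as H.
    assert (Htq : q * (t / q) = t) by (field; lra).
    assert (q + t <= q * exp (t / q)) by nra.
    apply Rle_trans with ((1 + c) * (q + t)); nra.
Qed.

(** * Interchanging the two sums *)

Lemma Series_tail (u : nat -> R) (N : nat) :
  ex_series u -> Series u - sum_n u N = Series (fun k => u (S N + k)%nat).
Proof.
  intros Hu. rewrite (Series_incr_n u (S N)) by (lia || assumption).
  rewrite sum_n_Reals. simpl pred. ring.
Qed.

Lemma Series_sum_n (c : nat -> nat -> R) (N : nat) :
  (forall i, ex_series (c i)) ->
  ex_series (fun j => sum_n (fun i => c i j) N) /\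
  Series (fun j => sum_n (fun i => c i j) N) = sum_n (fun i => Series (c i)) N.
Proof.
  intros Hc. induction N as [|N [IH1 IH2]].
  - split.
    + apply ex_series_ext with (c 0%nat); [|apply Hc]. intros j. now rewrite sum_O.
    + rewrite sum_O. apply Series_ext. intros j. now rewrite sum_O.
  - split.
    + apply ex_series_ext with (fun j => plus (sum_n (fun i => c i j) N) (c (S N) j)).
      * intros j. now rewrite sum_Sn.
      * now apply (ex_series_plus (V := R_NormedModule)).
    + rewrite sum_Sn, <- IH2. unfold plus; simpl. rewrite <- Series_plus by auto.
      apply Series_ext. intros j. now rewrite sum_Sn.
Qed.

(** Fubini for a dominated array: the partial row sums differ from the sum of the columns
    by at most the tail of [A] times the sum of [B]. *)
Lemma Series_swap (c : nat -> nat -> R) (A B : nat -> R) :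
  (forall i j, Rabs (c i j) <= A i * B j) -> (forall i, 0 <= A i) -> (forall j, 0 <= B j) ->
  ex_series A -> ex_series B ->
  Series (fun i => Series (c i)) = Series (fun j => Series (fun i => c i j)).
Proof.
  intros Hc HA0 HB0 HA HB.
  assert (Hex : forall i, ex_series (c i)).
  { intros i. apply (@ex_series_le R_AbsRing R_CompleteNormedModule) with (fun j => A i * B j).
    - intros j. apply Hc.
    - now apply (ex_series_scal (K := R_AbsRing) (V := R_NormedModule) (A i)). }
  assert (Hexj : forall j, ex_series (fun i => Rabs (c i j))).
  { intros j. apply (@ex_series_le R_AbsRing R_CompleteNormedModule) with (fun i => A i * B j).
    - intros i. unfold norm; simpl; unfold abs; simpl. rewrite Rabs_Rabsolu. apply Hc.
    - apply ex_series_ext with (fun i => B j * A i); [intros; simpl; ring|].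
      now apply (ex_series_scal (K := R_AbsRing) (V := R_NormedModule) (B j)). }
  assert (Htail : forall N j, Rabs (Series (fun i => c i j) - sum_n (fun i => c i j) N)
                   <= (Series A - sum_n A N) * B j).
  { intros N j. rewrite Series_tail by apply ex_series_Rabs, Hexj.
    rewrite Series_tail by assumption.
    rewrite Rmult_comm, <- Series_scal_l.
    assert (Hs : ex_series (fun k => B j * A (S N + k)%nat)).
    { apply (ex_series_scal (K := R_AbsRing) (V := R_NormedModule) (B j)).
      now apply (ex_series_incr_n (V := R_NormedModule)). }
    eapply Rle_trans.
    - apply Series_Rabs. now apply (ex_series_incr_n (fun i => Rabs (c i j))).
    - apply Series_le; [|exact Hs]. intros k. split; [apply Rabs_pos|].
      rewrite Rmult_comm. apply Hc. }
  assert (HexS : ex_series (fun j => Series (fun i => c i j))).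
  { apply (@ex_series_le R_AbsRing R_CompleteNormedModule) with (fun j => Series A * B j).
    - intros j. eapply Rle_trans; [apply Series_Rabs, Hexj|].
      rewrite Rmult_comm, <- Series_scal_l. apply Series_le.
      + intros i. split; [apply Rabs_pos|]. rewrite Rmult_comm. apply Hc.
      + now apply (ex_series_scal (K := R_AbsRing) (V := R_NormedModule) (B j)).
    - now apply (ex_series_scal (K := R_AbsRing) (V := R_NormedModule) (Series A)). }
  apply is_series_unique.
  change (is_lim_seq (sum_n (fun i => Series (c i))) (Series (fun j => Series (fun i => c i j)))).
  assert (Hdiff : is_lim_seq (fun N => (Series A - sum_n A N) * Series B) 0).
  { replace (Finite 0) with (Rbar_mult (Finite (Series A - Series A)) (Finite (Series B)))
      by (simpl; f_equal; ring).
    apply is_lim_seq_scal_r.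
    apply is_lim_seq_minus'; [apply is_lim_seq_const | now apply Series_correct]. }
  assert (Hz : is_lim_seq (fun N => Series (fun j => Series (fun i => c i j))
                 - sum_n (fun i => Series (c i)) N) 0).
  { apply is_lim_seq_abs_0.
    apply is_lim_seq_le_le with (fun _ => 0) (fun N => (Series A - sum_n A N) * Series B);
      [|apply is_lim_seq_const | exact Hdiff].
    intros N. split; [apply Rabs_pos|].
    destruct (Series_sum_n c N Hex) as [E1 E2]. rewrite <- E2, <- Series_minus by assumption.
    rewrite <- Series_scal_l.
    assert (Hs : ex_series (fun j => (Series A - sum_n A N) * B j))
      by now apply (ex_series_scal (K := R_AbsRing) (V := R_NormedModule)).
    eapply Rle_trans; [apply Series_Rabs|].
    - apply (@ex_series_le R_AbsRing R_CompleteNormedModule) with (2 := Hs).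
      intros j. unfold norm; simpl; unfold abs; simpl. rewrite Rabs_Rabsolu. apply Htail.
    - apply Series_le; [|exact Hs]. intros j. split; [apply Rabs_pos | apply Htail]. }
  apply is_lim_seq_ext with (fun N => Series (fun j => Series (fun i => c i j))
     - (Series (fun j => Series (fun i => c i j)) - sum_n (fun i => Series (c i)) N)).
  { intros N. ring. }
  replace (Finite (Series (fun j => Series (fun i => c i j))))
    with (Finite (Series (fun j => Series (fun i => c i j)) - 0)) by (f_equal; ring).
  apply is_lim_seq_minus'; [apply is_lim_seq_const | exact Hz].
Qed.

(** Domination by a product, so that both iterated sums converge absolutely and
    [Series_swap] applies. *)
Definition subexp2 (c : nat -> nat -> R) : Prop :=
  exists b b', subexp b /\ subexp b' /\ forall i j, Rabs (c i j) <= Rabs (b i) * Rabs (b' j).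

Definition expect2 (a : R) (n : nat) (x y : R) (c : nat -> nat -> R) : R :=
  expect a n x (fun i => expect a n y (c i)).

Lemma subexp2_tensor (b b' : nat -> R) :
  subexp b -> subexp b' -> subexp2 (fun i j => b i * b' j).
Proof.
  intros Hb Hb'. exists b, b'. repeat split; auto.
  intros. rewrite Rabs_mult. apply Rle_refl.
Qed.

Lemma subexp2_flip (c : nat -> nat -> R) : subexp2 c -> subexp2 (fun i j => c j i).
Proof.
  intros (b & b' & Hb & Hb' & H). exists b', b. repeat split; auto.
  intros. rewrite Rmult_comm. apply H.
Qed.

Lemma subexp2_plus (c d : nat -> nat -> R) :
  subexp2 c -> subexp2 d -> subexp2 (fun i j => c i j + d i j).
Proof.
  intros (b & b' & Hb & Hb' & H) (e & e' & He & He' & H').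
  exists (fun i => Rabs (b i) + Rabs (e i)), (fun j => Rabs (b' j) + Rabs (e' j)).
  repeat split; auto with subexp. intros i j.
  eapply Rle_trans; [apply Rabs_triang|].
  specialize (H i j). specialize (H' i j).
  pose proof (Rabs_pos (b i)). pose proof (Rabs_pos (b' j)).
  pose proof (Rabs_pos (e i)). pose proof (Rabs_pos (e' j)).
  rewrite (Rabs_pos_eq (Rabs (b i) + _)), (Rabs_pos_eq (Rabs (b' j) + _)) by lra.
  nra.
Qed.

Lemma subexp2_weight (s : nat -> R) (c : nat -> nat -> R) :
  subexp s -> subexp2 c -> subexp2 (fun i j => s i * c i j).
Proof.
  intros Hs (b & b' & Hb & Hb' & H).
  exists (fun i => s i * b i), b'. repeat split; auto with subexp.
  intros i j. rewrite !Rabs_mult, Rmult_assoc.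
  apply Rmult_le_compat_l; [apply Rabs_pos | apply H].
Qed.

Lemma subexp2_row (c : nat -> nat -> R) (i : nat) : subexp2 c -> subexp (c i).
Proof.
  intros (b & b' & Hb & Hb' & H).
  apply (subexp_le _ (fun j => Rabs (b i) * b' j)); [|auto with subexp].
  intros j. rewrite Rabs_mult, Rabs_Rabsolu. apply H.
Qed.

Lemma subexp_expect_rows (a : R) (n : nat) (y : R) (c : nat -> nat -> R) :
  0 <= a -> 0 <= y -> subexp2 c -> subexp (fun i => expect a n y (c i)).
Proof.
  intros Ha Hy (b & b' & Hb & Hb' & H).
  apply (subexp_le _ (fun i => expect a n y (fun j => Rabs (b' j)) * b i));
    [|auto with subexp].
  intros i. eapply Rle_trans.
  - apply expect_abs_le; [assumption|assumption|apply (H i)|].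
    apply ex_series_W; auto with subexp.
  - rewrite expect_scal, Rmult_comm, Rabs_mult.
    apply Rmult_le_compat_r; [apply Rabs_pos | apply Rle_abs].
Qed.

Lemma expect2_plus (a : R) (n : nat) (x y : R) (c d : nat -> nat -> R) :
  0 <= a -> 0 <= x -> 0 <= y -> subexp2 c -> subexp2 d ->
  expect2 a n x y (fun i j => c i j + d i j) = expect2 a n x y c + expect2 a n x y d.
Proof.
  intros Ha Hx Hy Hc Hd. unfold expect2.
  rewrite <- expect_plus by (assumption || now apply subexp_expect_rows).
  apply expect_ext. intros i. apply expect_plus; auto using subexp2_row.
Qed.

Lemma expect2_tensor (a : R) (n : nat) (x y : R) (b b' : nat -> R) :
  expect2 a n x y (fun i j => b i * b' j) = expect a n x b * expect a n y b'.
Proof.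
  unfold expect2. rewrite Rmult_comm, <- expect_scal. apply expect_ext.
  intros i. rewrite expect_scal. ring.
Qed.

Lemma expect2_ext (a : R) (n : nat) (x y : R) (c d : nat -> nat -> R) :
  (forall i j, c i j = d i j) -> expect2 a n x y c = expect2 a n x y d.
Proof. intros H. apply expect_ext. intros i. apply expect_ext, H. Qed.

Lemma expect2_flip (a : R) (n : nat) (x y : R) (c : nat -> nat -> R) :
  0 <= a -> 0 <= x -> 0 <= y -> subexp2 c ->
  expect2 a n x y c = expect2 a n y x (fun j i => c i j).
Proof.
  intros Ha Hx Hy (b & b' & Hb & Hb' & H). unfold expect2, expect.
  rewrite (Series_ext _ (fun i => Series (fun j => W a n i x * W a n j y * c i j))).
  2:{ intros i. rewrite <- Series_scal_l. apply Series_ext. intros; ring. }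
  rewrite (Series_swap _ (fun i => W a n i x * Rabs (b i)) (fun j => W a n j y * Rabs (b' j))).
  - apply Series_ext. intros j. rewrite <- Series_scal_l. apply Series_ext. intros; ring.
  - intros i j. rewrite !Rabs_mult.
    rewrite (Rabs_pos_eq (W a n i x)), (Rabs_pos_eq (W a n j y)) by now apply W_nonneg.
    replace (W a n i x * Rabs (b i) * (W a n j y * Rabs (b' j)))
      with (W a n i x * W a n j y * (Rabs (b i) * Rabs (b' j))) by ring.
    apply Rmult_le_compat_l; [|apply H]. apply Rmult_le_pos; now apply W_nonneg.
  - intros i. apply Rmult_le_pos; [now apply W_nonneg | apply Rabs_pos].
  - intros j. apply Rmult_le_pos; [now apply W_nonneg | apply Rabs_pos].
  - apply ex_series_W; auto with subexp.
  - apply ex_series_W; auto with subexp.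
Qed.

Lemma expect2_abs_le (a : R) (n : nat) (x y : R) (c : nat -> nat -> R) (b b' : nat -> R) :
  0 <= a -> 0 <= x -> 0 <= y ->
  (forall i j, Rabs (c i j) <= b i * b' j) ->
  ex_series (fun i => W a n i x * b i) -> ex_series (fun j => W a n j y * b' j) ->
  Rabs (expect2 a n x y c) <= expect a n x b * expect a n y b'.
Proof.
  intros Ha Hx Hy H Hb Hb'. rewrite Rmult_comm, <- expect_scal.
  apply expect_abs_le; try assumption.
  - intros i. rewrite Rmult_comm, <- expect_scal. apply expect_abs_le; auto.
    apply ex_series_ext with (fun j => b i * (W a n j y * b' j)); [intros; simpl; ring|].
    now apply (ex_series_scal (K := R_AbsRing) (V := R_NormedModule)).
  - apply ex_series_ext with (fun i => expect a n y b' * (W a n i x * b i));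
      [intros; simpl; ring|].
    now apply (ex_series_scal (K := R_AbsRing) (V := R_NormedModule)).
Qed.

#[local] Hint Resolve subexp_score : subexp.

(** * Moments of the cells *)

(** The average of [(u - x)^r] over the cell [[k / (n+1), (k+1) / (n+1)]]. *)
Definition cell_moment (n : nat) (x : R) (r k : nat) : R :=
  (INR n + 1) / INR (S r) * (((INR k + 1) / (INR n + 1) - x) ^ S r
                             - (INR k / (INR n + 1) - x) ^ S r).

(** The difference [mean a n x - (n + 1) x], which does not depend on [n]. *)
Definition shift (a x : R) : R := a * x / (1 + x) - x.

Lemma subexp_cell_moment (n : nat) (x : R) (r : nat) : subexp (cell_moment n x r).
Proof. unfold cell_moment, Rdiv. auto 20 with subexp. Qed.

#[local] Hint Resolve subexp_cell_moment : subexp.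

Lemma expect_centered_poly (a : R) (n : nat) (x c0 c1 c2 c3 c4 : R) (b : nat -> R) :
  0 <= a -> 0 < x ->
  (forall k, b k = c4 * (INR k - mean a n x) ^ 4 + (c3 * (INR k - mean a n x) ^ 3
             + (c2 * (INR k - mean a n x) ^ 2 + (c1 * (INR k - mean a n x) + c0 * 1)))) ->
  expect a n x b
  = c4 * (3 * cumulant2 a n x ^ 2 + cumulant4 a n x) + c3 * cumulant3 a n x
    + c2 * cumulant2 a n x + c0.
Proof.
  intros Ha Hx Hb. rewrite (expect_ext _ _ _ _ _ Hb).
  destruct (central_moments a n x Ha Hx) as (H1 & H2 & H3 & H4). cbv beta zeta in *.
  rewrite !expect_plus, !expect_scal by (lra || auto 10 with subexp).
  rewrite H1, H2, H3, H4, expect_one by lra. ring.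
Qed.

Ltac centered :=
  intros; unfold score, cell_moment, shift, mean; rewrite ?S_INR; simpl INR;
  field; repeat split; try lra;
  match goal with n : nat |- _ => pose proof (pos_INR n); lra end.

(** On the [k]-th cell, [(n + 1) (u - x) = (k - mean) + shift + tau] with [tau] uniform on
    [[0, 1]], so the average of a power is a polynomial in [k - mean]. *)
Lemma expect_cell_moments (a : R) (n : nat) (x : R) :
  0 <= a -> 0 < x ->
  let s := shift a x in
  let N := INR n + 1 in
  expect a n x (cell_moment n x 0) = 1 /\
  expect a n x (cell_moment n x 1) = (s + 1 / 2) / N /\
  expect a n x (cell_moment n x 2) = (cumulant2 a n x + (s ^ 2 + s + 1 / 3)) / N ^ 2 /\
  expect a n x (cell_moment n x 3)
  = (cumulant3 a n x + (3 * s + 3 / 2) * cumulant2 a n x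
     + (s ^ 3 + 3 / 2 * s ^ 2 + s + 1 / 4)) / N ^ 3.
Proof.
  intros Ha Hx s N. pose proof (pos_INR n). assert (HN : N <> 0) by (unfold N; lra).
  repeat split.
  - rewrite (expect_centered_poly a n x 1 0 0 0 0); auto; [ring|]. centered.
  - rewrite (expect_centered_poly a n x ((s + 1 / 2) / N) (/ N) 0 0 0); auto; [ring|].
    unfold s, N. centered.
  - rewrite (expect_centered_poly a n x ((s ^ 2 + s + 1 / 3) / N ^ 2)
               ((2 * s + 1) / N ^ 2) (/ N ^ 2) 0 0); auto; [field; assumption|].
    unfold s, N. centered.
  - rewrite (expect_centered_poly a n x ((s ^ 3 + 3 / 2 * s ^ 2 + s + 1 / 4) / N ^ 3)
               ((3 * s ^ 2 + 3 * s + 1) / N ^ 3) ((3 * s + 3 / 2) / N ^ 3) (/ N ^ 3) 0);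
      auto; [field; assumption|].
    unfold s, N. centered.
Qed.

Lemma expect_score_cell_moments (a : R) (n : nat) (x : R) :
  0 <= a -> 0 < x ->
  let s := shift a x in
  let N := INR n + 1 in
  let X := x * (1 + x) in
  let b := fun r k => score a n x k * cell_moment n x r k in
  expect a n x (b 0%nat) = 0 /\
  expect a n x (b 1%nat) = cumulant2 a n x / (X * N) /\
  expect a n x (b 2%nat)
  = (cumulant3 a n x + (2 * s + 1) * cumulant2 a n x) / (X * N ^ 2) /\
  expect a n x (b 3%nat)
  = (3 * cumulant2 a n x ^ 2 + cumulant4 a n x + (3 * s + 3 / 2) * cumulant3 a n x
     + (3 * s ^ 2 + 3 * s + 1) * cumulant2 a n x) / (X * N ^ 3).
Proof.
  intros Ha Hx s N X b. pose proof (pos_INR n). assert (HN : N <> 0) by (unfold N; lra).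
  assert (HX : X <> 0) by (unfold X; nra).
  repeat split.
  - rewrite (expect_centered_poly a n x 0 (/ X) 0 0 0); auto; [ring|].
    unfold b, s, N, X. centered.
  - rewrite (expect_centered_poly a n x 0 ((s + 1 / 2) / (X * N)) (/ (X * N)) 0 0); auto;
      [field; auto|].
    unfold b, s, N, X. centered.
  - rewrite (expect_centered_poly a n x 0 ((s ^ 2 + s + 1 / 3) / (X * N ^ 2))
               ((2 * s + 1) / (X * N ^ 2)) (/ (X * N ^ 2)) 0); auto; [field; auto|].
    unfold b, s, N, X. centered.
  - rewrite (expect_centered_poly a n x 0
               ((s ^ 3 + 3 / 2 * s ^ 2 + s + 1 / 4) / (X * N ^ 3))
               ((3 * s ^ 2 + 3 * s + 1) / (X * N ^ 3)) ((3 * s + 3 / 2) / (X * N ^ 3))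
               (/ (X * N ^ 3)));
      auto; [field; auto|].
    unfold b, s, N, X. centered.
Qed.

(** All the moments are rational in [n] and polynomial in [h = 1 / (n + 1)], so that their
    limits are values at [h = 0]. *)
Lemma is_lim_seq_of_inv (u : nat -> R) (phi : R -> R) (l : R) :
  (forall n, u n = phi (/ (INR n + 1))) -> ex_derive phi 0 -> phi 0 = l ->
  is_lim_seq u l.
Proof.
  intros Hu Hphi <-. apply is_lim_seq_ext with (fun n => phi (/ (INR n + 1))).
  { intros n. now rewrite Hu. }
  apply is_lim_seq_continuous.
  - apply continuity_pt_filterlim. apply (ex_derive_continuous phi 0 Hphi).
  - replace (Finite 0) with (Rbar_inv p_infty) by reflexivity.
    apply is_lim_seq_inv; [|discriminate].
    apply is_lim_seq_ext with (fun n => INR (S n)); [intros; apply S_INR|].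
    apply (is_lim_seq_incr_1 INR), is_lim_seq_INR.
Qed.

Ltac lim_by phi :=
  apply is_lim_seq_of_inv with phi;
  repeat match goal with v := _ : R |- _ => subst v end;
  [ let n := fresh "n" in intros n; pose proof (pos_INR n);
    unfold cumulant2, cumulant3, cumulant4; field; repeat split; lra
  | auto_derive; auto
  | unfold shift; field; repeat split; lra ].

Lemma cell_moment_limits (a x : R) :
  0 <= a -> 0 < x ->
  is_lim_seq (fun n => INR n * expect a n x (cell_moment n x 1)) (shift a x + 1 / 2) /\
  is_lim_seq (fun n => INR n * expect a n x (cell_moment n x 2)) (x * (1 + x)) /\
  is_lim_seq (fun n => INR n * expect a n x (cell_moment n x 3)) 0.
Proof.
  intros Ha Hx. set (s := shift a x). set (T := a * x / (1 + x)).
  repeat split.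
  - apply is_lim_seq_ext with (fun n => INR n * ((s + 1 / 2) / (INR n + 1))).
    { intros n. now rewrite (proj1 (proj2 (expect_cell_moments a n x Ha Hx))). }
    lim_by (fun h => (1 - h) * (s + 1 / 2)).
  - apply is_lim_seq_ext with
      (fun n => INR n * ((cumulant2 a n x + (s ^ 2 + s + 1 / 3)) / (INR n + 1) ^ 2)).
    { intros n. now rewrite (proj1 (proj2 (proj2 (expect_cell_moments a n x Ha Hx)))). }
    lim_by (fun h => (1 - h) * ((1 - h) * (x * (1 + x)) + h * T + h * (s ^ 2 + s + 1 / 3))).
  - apply is_lim_seq_ext with
      (fun n => INR n * ((cumulant3 a n x + (3 * s + 3 / 2) * cumulant2 a n x
         + (s ^ 3 + 3 / 2 * s ^ 2 + s + 1 / 4)) / (INR n + 1) ^ 3)).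
    { intros n. now rewrite (proj2 (proj2 (proj2 (expect_cell_moments a n x Ha Hx)))). }
    lim_by (fun h => (1 - h) * h *
      ((1 - h) * (x * (1 + x) * (1 + 2 * x)) + h * T
       + (3 * s + 3 / 2) * ((1 - h) * (x * (1 + x)) + h * T)
       + h * (s ^ 3 + 3 / 2 * s ^ 2 + s + 1 / 4))).
Qed.

Lemma score_cell_moment_limits (a x : R) :
  0 <= a -> 0 < x ->
  let B := fun r n => expect a n x (fun k => score a n x k * cell_moment n x r k) in
  is_lim_seq (fun n => INR n * (B 1%nat n - 1)) (- 1 + a / (1 + x) ^ 2) /\
  is_lim_seq (fun n => INR n * B 2%nat n) (2 * (1 + a * x / (1 + x))) /\
  is_lim_seq (fun n => INR n * B 3%nat n) (3 * (x * (1 + x))).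
Proof.
  intros Ha Hx B. set (s := shift a x). set (T := a * x / (1 + x)).
  repeat split.
  - apply is_lim_seq_ext with
      (fun n => INR n * (cumulant2 a n x / (x * (1 + x) * (INR n + 1)) - 1)).
    { intros n. unfold B.
      now rewrite (proj1 (proj2 (expect_score_cell_moments a n x Ha Hx))). }
    lim_by (fun h => (1 - h) * (- 1 + a / (1 + x) ^ 2)).
  - apply is_lim_seq_ext with
      (fun n => INR n * ((cumulant3 a n x + (2 * s + 1) * cumulant2 a n x)
                         / (x * (1 + x) * (INR n + 1) ^ 2))).
    { intros n. unfold B.
      now rewrite (proj1 (proj2 (proj2 (expect_score_cell_moments a n x Ha Hx)))). }
    lim_by (fun h => (1 - h) * ((1 - h) * (1 + 2 * x) + h * (a / (1 + x) ^ 2)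
              + (2 * s + 1) * ((1 - h) + h * (a / (1 + x) ^ 2)))).
  - apply is_lim_seq_ext with
      (fun n => INR n * ((3 * cumulant2 a n x ^ 2 + cumulant4 a n x
         + (3 * s + 3 / 2) * cumulant3 a n x
         + (3 * s ^ 2 + 3 * s + 1) * cumulant2 a n x) / (x * (1 + x) * (INR n + 1) ^ 3))).
    { intros n. unfold B.
      now rewrite (proj2 (proj2 (proj2 (expect_score_cell_moments a n x Ha Hx)))). }
    lim_by (fun h => (1 - h) *
      (3 * ((1 - h) * (x * (1 + x)) + h * T) * ((1 - h) + h * (a / (1 + x) ^ 2))
       + h * ((1 - h) * (1 + 6 * x + 6 * x ^ 2) + h * (a / (1 + x) ^ 2))
       + (3 * s + 3 / 2) * h * ((1 - h) * (1 + 2 * x) + h * (a / (1 + x) ^ 2))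
       + (3 * s ^ 2 + 3 * s + 1) * h * ((1 - h) + h * (a / (1 + x) ^ 2)))).
Qed.

(** * The limit for an array of coefficients *)

Lemma is_derive_expect2 (a : R) (n : nat) (x y : R) (c : nat -> nat -> R) :
  0 <= a -> 0 < x -> 0 <= y -> subexp2 c ->
  is_derive (fun w : R => expect2 a n w y c) x
            (expect2 a n x y (fun i j => score a n x i * c i j)).
Proof.
  intros Ha Hx Hy Hc. unfold expect2.
  rewrite (expect_ext _ _ _ _ (fun i => score a n x i * expect a n y (c i)))
    by (intros; apply expect_scal).
  apply is_derive_expect; auto using subexp_expect_rows.
Qed.

(** The indices range over a square rather than over [r + s <= 3], so that the two
    variables separate; the surplus coefficients of [p] will be zero. *)
Definition taylor_cells (p : nat -> nat -> R) (n : nat) (x y : R) (i j : nat) : R :=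
  sum_n (fun r => sum_n (fun s =>
    p r s * (cell_moment n x r i * cell_moment n y s j)) 3) 3.

Lemma subexp2_ext (c d : nat -> nat -> R) :
  (forall i j, c i j = d i j) -> subexp2 c -> subexp2 d.
Proof.
  intros H (b & b' & Hb & Hb' & Hc). exists b, b'. repeat split; auto.
  intros i j. rewrite <- H. apply Hc.
Qed.

Lemma subexp2_sum_n (c : nat -> nat -> nat -> R) (N : nat) :
  (forall r, subexp2 (c r)) -> subexp2 (fun i j => sum_n (fun r => c r i j) N).
Proof.
  intros Hc. induction N as [|N IH].
  - apply (subexp2_ext (c 0%nat)); [|apply Hc]. intros; now rewrite sum_O.
  - apply (subexp2_ext (fun i j => sum_n (fun r => c r i j) N + c (S N) i j)).
    + intros; now rewrite sum_Sn.
    + apply subexp2_plus; auto.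
Qed.

Lemma expect2_sum_n (a : R) (n : nat) (x y : R) (c : nat -> nat -> nat -> R) (N : nat) :
  0 <= a -> 0 <= x -> 0 <= y -> (forall r, subexp2 (c r)) ->
  expect2 a n x y (fun i j => sum_n (fun r => c r i j) N)
  = sum_n (fun r => expect2 a n x y (c r)) N.
Proof.
  intros Ha Hx Hy Hc. induction N as [|N IH].
  - rewrite sum_O. apply expect2_ext. intros; now rewrite sum_O.
  - rewrite sum_Sn, <- IH.
    change (expect2 a n x y (fun i j => sum_n (fun r => c r i j) (S N))
      = expect2 a n x y (fun i j => sum_n (fun r => c r i j) N) + expect2 a n x y (c (S N))).
    rewrite <- expect2_plus by auto using subexp2_sum_n.
    apply expect2_ext. intros; now rewrite sum_Sn.
Qed.

Lemma subexp2_scal (l : R) (c : nat -> nat -> R) :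
  subexp2 c -> subexp2 (fun i j => l * c i j).
Proof. apply (subexp2_weight (fun _ => l)), subexp_const. Qed.

Lemma subexp2_taylor_cells (p : nat -> nat -> R) (n : nat) (x y : R) :
  subexp2 (taylor_cells p n x y).
Proof.
  unfold taylor_cells. apply (subexp2_sum_n (fun r i j => sum_n _ 3)). intros r.
  apply (subexp2_sum_n (fun s i j => p r s * _)). intros s.
  apply subexp2_scal, subexp2_tensor; auto with subexp.
Qed.

Lemma expect2_score_taylor_cells (a : R) (p : nat -> nat -> R) (n : nat) (x y : R) :
  0 <= a -> 0 < x -> 0 < y ->
  expect2 a n x y (fun i j => score a n x i * taylor_cells p n x y i j)
  = sum_n (fun r => sum_n (fun s =>
      p r s * (expect a n x (fun k => score a n x k * cell_moment n x r k)
               * expect a n y (cell_moment n y s))) 3) 3.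
Proof.
  intros Ha Hx Hy.
  assert (Hs : forall r s, subexp2 (fun i j =>
            p r s * ((score a n x i * cell_moment n x r i) * cell_moment n y s j))).
  { intros r s. apply subexp2_scal.
    apply (subexp2_tensor (fun i => score a n x i * cell_moment n x r i)); auto with subexp. }
  rewrite (expect2_ext _ _ _ _ _ (fun i j => sum_n (fun r => sum_n (fun s =>
     p r s * ((score a n x i * cell_moment n x r i) * cell_moment n y s j)) 3) 3)).
  2:{ intros i j. unfold taylor_cells. rewrite <- (sum_n_mult_l (K := R_Ring)).
      apply sum_n_ext. intros r. rewrite <- (sum_n_mult_l (K := R_Ring)).
      apply sum_n_ext. intros s. unfold mult; simpl. ring. }
  rewrite expect2_sum_n by (lra || (intros r; now apply subexp2_sum_n)).
  apply sum_n_ext. intros r. rewrite expect2_sum_n by (lra || auto).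
  apply sum_n_ext. intros s.
  rewrite <- expect2_tensor. unfold expect2. rewrite <- expect_scal.
  apply expect_ext. intros i. now rewrite <- expect_scal.
Qed.

(** The score is of order [sqrt n * dev], and the extra factor [dev] is absorbed in
    [exp (dev / 2)]; the factors [n] and [sqrt n] cancel the size [n^(-3/2)] of the
    remainder, and what is left is [eta] times two bounded exponential moments. *)
Lemma score_remainder_small (a x y : R) (r : nat -> nat -> nat -> R) :
  0 <= a -> 0 < x -> 0 < y ->
  (forall eta, 0 < eta -> exists N, forall n, (N <= n)%nat -> (1 <= n)%nat -> forall i j,
     Rabs (r n i j) <= eta / (INR n * sqrt (INR n))
                       * (exp (dev a n x i / 2) * exp (dev a n y j / 2))) ->
  is_lim_seq (fun n => INR n * expect2 a n x y (fun i j => score a n x i * r n i j)) 0.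
Proof.
  intros Ha Hx Hy Hr.
  destruct (exp_dev_bounded a x Ha Hx) as (Bx & Nx & HBx & HEx).
  destruct (exp_dev_bounded a y Ha Hy) as (By & Ny & HBy & HEy).
  set (X := x * (1 + x)). assert (HX : 0 < X) by (unfold X; nra).
  apply is_lim_seq_spec. intros eps.
  assert (HBB : 0 < Bx * By) by nra.
  set (eta := eps * X / (4 * (Bx * By))).
  assert (Heta : 0 < eta).
  { apply Rdiv_lt_0_compat; [|lra]. apply Rmult_lt_0_compat; [apply cond_pos | exact HX]. }
  destruct (Hr eta Heta) as [N HN].
  exists (N + Nx + Ny + 1)%nat. intros n Hn. rewrite Rminus_0_r.
  assert (Hn1 : (1 <= n)%nat) by lia.
  assert (HnR : 1 <= INR n) by (apply (le_INR 1); lia).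
  assert (Hsq : 0 < sqrt (INR n)) by (apply sqrt_lt_R0; lra).
  destruct (HEx n) as [Sx Ex]; [lia|lia|]. destruct (HEy n) as [Sy Ey]; [lia|lia|].
  specialize (HN n ltac:(lia) Hn1).
  assert (Hdom : forall i j, Rabs (score a n x i * r n i j)
            <= (2 * eta / (INR n * X) * exp (dev a n x i)) * exp (dev a n y j)).
  { intros i j. rewrite Rabs_mult.
    pose proof (dev_nonneg a n x i Hn1) as Di. pose proof (dev_nonneg a n y j Hn1) as Dj.
    assert (Hscore : Rabs (score a n x i) = dev a n x i * sqrt (INR n) / X).
    { unfold score, dev, X, Rdiv. rewrite Rabs_mult, (Rabs_pos_eq (/ _)).
      - field. split; [nra|lra].
      - left. now apply Rinv_0_lt_compat. }
    pose proof (exp_ineq1_le (dev a n x i / 2)) as He.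
    assert (Hexp : forall t, exp t = exp (t / 2) * exp (t / 2)).
    { intros t. rewrite <- exp_plus. f_equal. field. }
    assert (Hj : exp (dev a n y j / 2) <= exp (dev a n y j)) by (apply exp_mono; lra).
    apply Rle_trans with ((2 * exp (dev a n x i / 2) * sqrt (INR n) / X)
      * (eta / (INR n * sqrt (INR n)) * (exp (dev a n x i / 2) * exp (dev a n y j)))).
    - apply Rmult_le_compat; try apply Rabs_pos.
      + rewrite Hscore. unfold Rdiv. apply Rmult_le_compat_r.
        * left. now apply Rinv_0_lt_compat.
        * apply Rmult_le_compat_r; lra.
      + eapply Rle_trans; [apply HN|]. apply Rmult_le_compat_l.
        * left. apply Rdiv_lt_0_compat; [lra|]. apply Rmult_lt_0_compat; lra.
        * apply Rmult_le_compat_l; [left; apply exp_pos | exact Hj].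
    - rewrite (Hexp (dev a n x i)). right. field. repeat split; lra. }
  assert (Sx' : ex_series (fun k => W a n k x * (2 * eta / (INR n * X) * exp (dev a n x k)))).
  { apply ex_series_ext with
      (fun k => 2 * eta / (INR n * X) * (W a n k x * exp (dev a n x k))).
    - intros; simpl; ring.
    - now apply (ex_series_scal (K := R_AbsRing) (V := R_NormedModule)). }
  pose proof (expect2_abs_le a n x y _ _ _ Ha (Rlt_le _ _ Hx) (Rlt_le _ _ Hy) Hdom Sx' Sy)
    as Hle.
  rewrite expect_scal in Hle. rewrite Rabs_mult, (Rabs_pos_eq (INR n)) by lra.
  assert (Ex0 : 0 <= expect a n x (fun k => exp (dev a n x k))).
  { eapply Rle_trans; [apply Rabs_pos|].
    apply (expect_abs_le a n x (fun k => exp (dev a n x k))); try lra; [|exact Sx].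
    intros k. rewrite Rabs_pos_eq; [lra | left; apply exp_pos]. }
  assert (Ey0 : 0 <= expect a n y (fun k => exp (dev a n y k))).
  { eapply Rle_trans; [apply Rabs_pos|].
    apply (expect_abs_le a n y (fun k => exp (dev a n y k))); try lra; [|exact Sy].
    intros k. rewrite Rabs_pos_eq; [lra | left; apply exp_pos]. }
  assert (Hprod : expect a n x (fun k => exp (dev a n x k))
                  * expect a n y (fun k => exp (dev a n y k)) <= Bx * By)
    by (apply Rmult_le_compat; assumption).
  apply Rle_lt_trans with (2 * eta / X * (Bx * By)).
  - apply Rle_trans with (2 * eta / X * (expect a n x (fun k => exp (dev a n x k))
                  * expect a n y (fun k => exp (dev a n y k)))).
    + apply Rmult_le_compat_l with (r := INR n) in Hle; [|lra].
      eapply Rle_trans; [exact Hle|]. right. field. split; lra.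
    + apply Rmult_le_compat_l; [|exact Hprod]. left. apply Rdiv_lt_0_compat; lra.
  - unfold eta. pose proof (cond_pos eps).
    replace (2 * (eps * X / (4 * (Bx * By))) / X * (Bx * By)) with (eps / 2).
    + lra.
    + field. repeat split; lra.
Qed.

(** On a product of powers, the weighted expectation factors. The score has mean 0, the
    score moment of [u - x] tends to 1, and all other moments of positive order are
    [O(1/n)]; hence of the ten coefficients only [p 1 0], [p 2 0], [p 3 0], [p 1 1] and
    [p 1 2] survive after multiplication by [n]. *)
Lemma score_taylor_limit (a x y : R) (p : nat -> nat -> R) :
  0 <= a -> 0 < x -> 0 < y -> (forall r s, (3 < r + s)%nat -> p r s = 0) ->
  is_lim_seq
    (fun n => INR n * (expect2 a n x y
                (fun i j => score a n x i * taylor_cells p n x y i j) - p 1%nat 0%nat))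
    ((- 1 + a / (1 + x) ^ 2) * p 1%nat 0%nat
     + 2 * (1 + a * x / (1 + x)) * p 2%nat 0%nat
     + (shift a y + 1 / 2) * p 1%nat 1%nat
     + y * (1 + y) * p 1%nat 2%nat
     + 3 * (x * (1 + x)) * p 3%nat 0%nat).
Proof.
  intros Ha Hx Hy Hp.
  set (B := fun r n => expect a n x (fun k => score a n x k * cell_moment n x r k)).
  set (A := fun s n => expect a n y (cell_moment n y s)).
  destruct (score_cell_moment_limits a x Ha Hx) as (B1 & B2 & B3).
  change (is_lim_seq (fun n => INR n * (B 1%nat n - 1)) (- 1 + a / (1 + x) ^ 2)) in B1.
  change (is_lim_seq (fun n => INR n * B 2%nat n) (2 * (1 + a * x / (1 + x)))) in B2.
  change (is_lim_seq (fun n => INR n * B 3%nat n) (3 * (x * (1 + x)))) in B3.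
  destruct (cell_moment_limits a y Ha Hy) as (A1 & A2 & _).
  change (is_lim_seq (fun n => INR n * A 1%nat n) (shift a y + 1 / 2)) in A1.
  change (is_lim_seq (fun n => INR n * A 2%nat n) (y * (1 + y))) in A2.
  apply is_lim_seq_ext with (fun n =>
    (INR n * (B 1%nat n - 1)) * p 1%nat 0%nat
    + (INR n * B 2%nat n) * p 2%nat 0%nat
    + (INR n * A 1%nat n) * p 1%nat 1%nat
    + (INR n * A 2%nat n) * p 1%nat 2%nat
    + (INR n * B 3%nat n) * p 3%nat 0%nat
    + ((INR n * (B 1%nat n - 1)) * (A 1%nat n * p 1%nat 1%nat + A 2%nat n * p 1%nat 2%nat)
       + (INR n * B 2%nat n) * (A 1%nat n * p 2%nat 1%nat))).
  { intros n. rewrite expect2_score_taylor_cells by assumption.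
    rewrite (sum_n_ext _ (fun r => sum_n (fun s => p r s * (B r n * A s n)) 3))
      by reflexivity.
    assert (B0 : B 0%nat n = 0) by apply (expect_score_cell_moments a n x Ha Hx).
    assert (A0 : A 0%nat n = 1) by apply (expect_cell_moments a n y Ha Hy).
    rewrite !sum_Sn, !sum_O, !sum_Sn, !sum_O, B0, A0. unfold plus; simpl.
    rewrite (Hp 1%nat 3%nat), (Hp 2%nat 2%nat), (Hp 2%nat 3%nat), (Hp 3%nat 1%nat),
      (Hp 3%nat 2%nat), (Hp 3%nat 3%nat) by lia.
    ring. }
  (* Quantities of order [1 / n] tend to 0; this disposes of the products of two of them. *)
  assert (Hvanish : forall u l, is_lim_seq (fun n => INR n * u n) (Finite l) ->
            is_lim_seq u 0).
  { intros u l Hu.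
    apply is_lim_seq_ext_loc with (fun n => (INR n * u n) * / INR n).
    - exists 1%nat. intros n Hn. field. apply not_0_INR. lia.
    - replace (Finite 0) with (Finite (l * 0)) by (f_equal; ring).
      apply is_lim_seq_mult'; [exact Hu|].
      replace (Finite 0) with (Rbar_inv p_infty) by reflexivity.
      apply is_lim_seq_inv; [apply is_lim_seq_INR | discriminate]. }
  pose proof (Hvanish _ _ A1) as A1'. pose proof (Hvanish _ _ A2) as A2'.
  match goal with |- is_lim_seq _ (Finite ?L) =>
    replace L with
     ((- 1 + a / (1 + x) ^ 2) * p 1%nat 0%nat
     + 2 * (1 + a * x / (1 + x)) * p 2%nat 0%nat
     + (shift a y + 1 / 2) * p 1%nat 1%nat
     + y * (1 + y) * p 1%nat 2%nat
     + 3 * (x * (1 + x)) * p 3%nat 0%nat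
     + ((- 1 + a / (1 + x) ^ 2) * (0 * p 1%nat 1%nat + 0 * p 1%nat 2%nat)
        + 2 * (1 + a * x / (1 + x)) * (0 * p 2%nat 1%nat)))
    by ring end.
  clearbody A B.
  repeat first [exact A1 | exact A2 | exact B1 | exact B2 | exact B3 | exact A1' | exact A2'
    | apply is_lim_seq_const | apply is_lim_seq_plus' | apply is_lim_seq_mult'].
Qed.

(** Stated for an arbitrary array [c n] because it serves twice: for the cell averages of
    [f], and for their transpose with [x] and [y] exchanged. *)
Theorem derivative_limit (a x y : R) (p : nat -> nat -> R) (c : nat -> nat -> nat -> R) :
  0 <= a -> 0 < x -> 0 < y -> (forall r s, (3 < r + s)%nat -> p r s = 0) ->
  (forall n, subexp2 (c n)) ->
  (forall eta, 0 < eta -> exists N, forall n, (N <= n)%nat -> (1 <= n)%nat -> forall i j,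
     Rabs (c n i j - taylor_cells p n x y i j)
     <= eta / (INR n * sqrt (INR n))
        * (exp (dev a n x i / 2) * exp (dev a n y j / 2))) ->
  is_lim_seq
    (fun n => INR n * (Derive (fun w => expect2 a n w y (c n)) x - p 1%nat 0%nat))
    ((- 1 + a / (1 + x) ^ 2) * p 1%nat 0%nat
     + 2 * (1 + a * x / (1 + x)) * p 2%nat 0%nat
     + (shift a y + 1 / 2) * p 1%nat 1%nat
     + y * (1 + y) * p 1%nat 2%nat
     + 3 * (x * (1 + x)) * p 3%nat 0%nat).
Proof.
  intros Ha Hx Hy Hp Hc Hrem.
  pose proof (score_taylor_limit a x y p Ha Hx Hy Hp) as Hmain.
  pose proof (score_remainder_small a x y (fun n i j => c n i j - taylor_cells p n x y i j)
                Ha Hx Hy Hrem) as Hsmall.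
  pose proof (is_lim_seq_plus' _ _ _ _ Hmain Hsmall) as H. rewrite Rplus_0_r in H.
  revert H. apply is_lim_seq_ext. intros n.
  rewrite (is_derive_unique _ _ _ (is_derive_expect2 a n x y (c n) Ha Hx (Rlt_le _ _ Hy) (Hc n))).
  assert (Hr : subexp2 (fun i j => c n i j - taylor_cells p n x y i j)).
  { apply (subexp2_ext (fun i j => c n i j + (-1) * taylor_cells p n x y i j)).
    - intros; ring.
    - apply subexp2_plus; [apply Hc | apply subexp2_scal, subexp2_taylor_cells]. }
  rewrite (expect2_ext a n x y (fun i j => score a n x i * c n i j)
     (fun i j => score a n x i * taylor_cells p n x y i j
                 + score a n x i * (c n i j - taylor_cells p n x y i j)))
    by (intros; ring).
  rewrite expect2_plus; try lra.
  - apply subexp2_weight; auto using subexp_score, subexp2_taylor_cells.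
  - now apply subexp2_weight; auto using subexp_score.
Qed.

(** * Integrals over a box *)

Lemma ex_RInt_inner (F : R -> R -> R) (v a b : R) :
  (forall u w, continuity_2d_pt F u w) -> ex_RInt (fun u => F u v) a b.
Proof.
  intros HF. apply (@ex_RInt_continuous R_CompleteNormedModule). intros u _.
  apply (continuous_comp_2 (fun u : R => u) (fun _ => v) F).
  - apply continuous_id.
  - apply continuous_const.
  - apply (proj1 (continuity_2d_pt_filterlim F u v)), HF.
Qed.

(** The inner integral is a continuous function of [v], by uniform continuity of [F]
    around the segment at height [v]. *)
Lemma ex_RInt_outer (F : R -> R -> R) (a b c d : R) :
  (forall u w, continuity_2d_pt F u w) -> a <= b ->
  ex_RInt (fun v => RInt (fun u => F u v) a b) c d.
Proof.
  intros HF Hab. apply (@ex_RInt_continuous R_CompleteNormedModule). intros v _.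
  apply continuity_pt_filterlim. intros eps Heps.
  assert (He : 0 < eps / (2 * (b - a + 1))) by (apply Rdiv_lt_0_compat; lra).
  destruct (uniform_continuity_2d_1d' (fun w u => F u w) a b v) with (mkposreal _ He)
    as [delta Hd].
  { intros u Hu. generalize (HF u v). intros H e. destruct (H e) as [dl Hdl].
    exists dl. intros s t Hs Ht. now apply Hdl. }
  simpl in Hd. exists delta. split; [apply cond_pos|].
  intros w [_ Hw]. unfold dist in *; simpl in *. unfold R_dist in *.
  apply Rabs_lt_between in Hw. pose proof (cond_pos delta).
  rewrite <- (RInt_minus (V := R_CompleteNormedModule)) by now apply ex_RInt_inner.
  apply Rle_lt_trans with ((b - a) * (eps / (2 * (b - a + 1)))).
  - apply abs_RInt_le_const; [assumption| |].
    + apply (ex_RInt_minus (V := R_NormedModule)); now apply ex_RInt_inner.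
    + intros u Hu. left. apply (Hd u v u w); try lra.
      rewrite Rminus_eq_0, Rabs_R0. assumption.
  - apply Rmult_lt_reg_r with (2 * (b - a + 1)); [lra|].
    replace ((b - a) * (eps / (2 * (b - a + 1))) * (2 * (b - a + 1)))
      with ((b - a) * eps) by (field; lra).
    nra.
Qed.

Definition box_int (F : R -> R -> R) (a b c d : R) : R :=
  RInt (fun v => RInt (fun u => F u v) a b) c d.

Lemma box_int_abs_le (F : R -> R -> R) (a b c d B : R) :
  (forall u w, continuity_2d_pt F u w) -> a <= b -> c <= d ->
  (forall u v, a <= u <= b -> c <= v <= d -> Rabs (F u v) <= B) ->
  Rabs (box_int F a b c d) <= (b - a) * (d - c) * B.
Proof.
  intros HF Hab Hcd HB.
  replace ((b - a) * (d - c) * B) with ((d - c) * ((b - a) * B)) by ring.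
  apply abs_RInt_le_const; [assumption | now apply ex_RInt_outer |].
  intros v Hv. apply abs_RInt_le_const; [assumption | now apply ex_RInt_inner |].
  intros u Hu. now apply HB.
Qed.

Lemma box_int_minus (F G : R -> R -> R) (a b c d : R) :
  (forall u w, continuity_2d_pt F u w) -> (forall u w, continuity_2d_pt G u w) -> a <= b ->
  box_int F a b c d - box_int G a b c d = box_int (fun u v => F u v - G u v) a b c d.
Proof.
  intros HF HG Hab. unfold box_int.
  rewrite <- (RInt_minus (V := R_CompleteNormedModule)) by now apply ex_RInt_outer.
  apply RInt_ext. intros v _.
  symmetry. apply (RInt_minus (V := R_CompleteNormedModule)); now apply ex_RInt_inner.
Qed.

Lemma is_RInt_sum_n (F : nat -> R -> R) (I : nat -> R) (a b : R) (N : nat) :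
  (forall r, is_RInt (F r) a b (I r)) ->
  is_RInt (fun u => sum_n (fun r => F r u) N) a b (sum_n I N).
Proof.
  intros H. induction N as [|N IH].
  - rewrite sum_O. apply (is_RInt_ext (F 0%nat)); [|apply H].
    intros. now rewrite sum_O.
  - rewrite sum_Sn. apply (is_RInt_ext (fun u => plus (sum_n (fun r => F r u) N) (F (S N) u))).
    + intros. now rewrite sum_Sn.
    + now apply (is_RInt_plus (V := R_NormedModule)).
Qed.

Lemma is_RInt_monomial (x a b : R) (r : nat) :
  is_RInt (fun u => (u - x) ^ r) a b (((b - x) ^ S r - (a - x) ^ S r) / INR (S r)).
Proof.
  assert (H0 : INR (S r) <> 0) by (apply not_0_INR; lia).
  replace (((b - x) ^ S r - (a - x) ^ S r) / INR (S r))
    with ((b - x) ^ S r / INR (S r) - (a - x) ^ S r / INR (S r)) by (field; assumption).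
  apply (is_RInt_derive (fun u => (u - x) ^ S r / INR (S r))).
  - intros u _. auto_derive; [auto|]. 
    change (1 * (INR (S r) * (u - x) ^ r) * / INR (S r) = (u - x) ^ r).
    field. assumption.
  - intros u _. apply (ex_derive_continuous (fun u : R => (u - x) ^ r)). auto_derive. auto.
Qed.

Definition taylor_poly (p : nat -> nat -> R) (x y u v : R) : R :=
  sum_n (fun r => sum_n (fun s => p r s * ((u - x) ^ r * (v - y) ^ s)) 3) 3.

Lemma continuity_2d_pt_pow (F : R -> R -> R) (r : nat) (u v : R) :
  continuity_2d_pt F u v -> continuity_2d_pt (fun s t => F s t ^ r) u v.
Proof.
  intros HF. induction r as [|r IH]; simpl.
  - apply continuity_2d_pt_const.
  - now apply continuity_2d_pt_mult.
Qed.

Lemma continuity_2d_pt_sum_n (F : nat -> R -> R -> R) (N : nat) (u v : R) :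
  (forall r, continuity_2d_pt (F r) u v) ->
  continuity_2d_pt (fun s t => sum_n (fun r => F r s t) N) u v.
Proof.
  intros HF. induction N as [|N IH].
  - apply (continuity_2d_pt_ext (F 0%nat)); [|apply HF]. intros; now rewrite sum_O.
  - apply (continuity_2d_pt_ext (fun s t => sum_n (fun r => F r s t) N + F (S N) s t)).
    + intros. now rewrite sum_Sn.
    + now apply continuity_2d_pt_plus.
Qed.

Lemma taylor_poly_continuous (p : nat -> nat -> R) (x y u v : R) :
  continuity_2d_pt (taylor_poly p x y) u v.
Proof.
  unfold taylor_poly. apply (continuity_2d_pt_sum_n (fun r s t => sum_n _ 3)). intros r.
  apply (continuity_2d_pt_sum_n (fun q s t => p r q * _)). intros q.
  apply continuity_2d_pt_mult; [apply continuity_2d_pt_const|].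
  apply continuity_2d_pt_mult; apply continuity_2d_pt_pow;
    apply continuity_2d_pt_minus; auto using continuity_2d_pt_const,
      continuity_2d_pt_id1, continuity_2d_pt_id2.
Qed.

Definition cell_mean (n : nat) (F : R -> R -> R) (i j : nat) : R :=
  (INR n + 1) * (INR n + 1) *
  box_int F (INR i / (INR n + 1)) ((INR i + 1) / (INR n + 1))
            (INR j / (INR n + 1)) ((INR j + 1) / (INR n + 1)).

Lemma cell_mean_taylor (p : nat -> nat -> R) (x y : R) (n i j : nat) :
  cell_mean n (taylor_poly p x y) i j = taylor_cells p n x y i j.
Proof.
  unfold cell_mean, box_int, taylor_poly.
  set (m := fun z r k => (((INR k + 1) / (INR n + 1) - z) ^ S r
                          - (INR k / (INR n + 1) - z) ^ S r) / INR (S r)).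
  assert (Hm : forall z r k, cell_moment n z r k = (INR n + 1) * m z r k).
  { intros z r k. unfold cell_moment, m, Rdiv. ring. }
  rewrite (RInt_ext _ (fun v => sum_n (fun r => sum_n (fun s =>
             p r s * (m x r i * (v - y) ^ s)) 3) 3)).
  2:{ intros v _. apply is_RInt_unique.
      apply (is_RInt_sum_n (fun r u => sum_n (fun s => p r s * ((u - x) ^ r * (v - y) ^ s)) 3)).
      intros r. apply (is_RInt_sum_n (fun s u => p r s * ((u - x) ^ r * (v - y) ^ s))).
      intros s. apply (is_RInt_scal (V := R_NormedModule)).
      apply (is_RInt_ext (fun u => (v - y) ^ s * (u - x) ^ r)); [intros; apply Rmult_comm|].
      rewrite Rmult_comm. apply (is_RInt_scal (V := R_NormedModule)), is_RInt_monomial. }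
  rewrite (is_RInt_unique _ _ _ (sum_n (fun r => sum_n (fun s =>
             p r s * (m x r i * m y s j)) 3) 3)).
  2:{ apply (is_RInt_sum_n (fun r v => sum_n (fun s => p r s * (m x r i * (v - y) ^ s)) 3)).
      intros r. apply (is_RInt_sum_n (fun s v => p r s * (m x r i * (v - y) ^ s))).
      intros s. apply (is_RInt_scal (V := R_NormedModule)).
      apply (is_RInt_scal (V := R_NormedModule)), is_RInt_monomial. }
  unfold taylor_cells.
  rewrite <- (sum_n_mult_l (K := R_Ring)). apply sum_n_ext. intros r.
  rewrite <- (sum_n_mult_l (K := R_Ring)). apply sum_n_ext. intros s.
  rewrite !Hm. unfold mult; simpl. ring.
Qed.

Lemma cell_mean_close (n : nat) (F G : R -> R -> R) (i j : nat) (B : R) :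
  (forall u w, continuity_2d_pt F u w) -> (forall u w, continuity_2d_pt G u w) ->
  (forall u v, INR i <= (INR n + 1) * u <= INR i + 1 ->
               INR j <= (INR n + 1) * v <= INR j + 1 -> Rabs (F u v - G u v) <= B) ->
  Rabs (cell_mean n F i j - cell_mean n G i j) <= B.
Proof.
  intros HF HG HB. pose proof (pos_INR n).
  assert (Hlen : forall k, (INR k + 1) / (INR n + 1) - INR k / (INR n + 1) = / (INR n + 1)).
  { intros k. field. lra. }
  assert (Hinv : 0 < / (INR n + 1)) by (apply Rinv_0_lt_compat; lra).
  assert (Hcell : forall k u, INR k / (INR n + 1) <= u <= (INR k + 1) / (INR n + 1) ->
            INR k <= (INR n + 1) * u <= INR k + 1).
  { intros k u [H1 H2].
    apply Rmult_le_compat_l with (r := INR n + 1) in H1, H2; try lra.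
    replace ((INR n + 1) * (INR k / (INR n + 1))) with (INR k) in H1 by (field; lra).
    replace ((INR n + 1) * ((INR k + 1) / (INR n + 1))) with (INR k + 1) in H2
      by (field; lra). lra. }
  unfold cell_mean. rewrite <- Rmult_minus_distr_l.
  pose proof (Hlen i) as Li. pose proof (Hlen j) as Lj.
  rewrite box_int_minus by (auto; lra).
  rewrite Rabs_mult, Rabs_pos_eq by nra.
  apply Rle_trans with ((INR n + 1) * (INR n + 1) *
    (/ (INR n + 1) * / (INR n + 1) * B)); [|right; field; lra].
  apply Rmult_le_compat_l; [nra|]. rewrite <- Li at 1. rewrite <- Lj at 1.
  apply box_int_abs_le; try lra.
  - intros. now apply continuity_2d_pt_minus.
  - intros u v Hu Hv. apply HB; auto.
Qed.

(** * Taylor expansion at an interior point *)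

(** By the mean value theorem, hence with the constant [eps] rather than [eps / (m + 1)];
    iterated, it yields Taylor expansions with the remainder of Peano. *)
Lemma integrate_bound (h dh : R -> R) (x delta eps : R) (m : nat) :
  (forall t, Rabs (t - x) < delta -> is_derive h t (dh t)) -> h x = 0 ->
  (forall t, Rabs (t - x) < delta -> Rabs (dh t) <= eps * Rabs (t - x) ^ m) -> 0 <= eps ->
  forall t, Rabs (t - x) < delta -> Rabs (h t) <= eps * Rabs (t - x) ^ S m.
Proof.
  intros Hd H0 Hb Heps t Ht.
  assert (Hin : forall s, Rmin x t <= s <= Rmax x t -> Rabs (s - x) <= Rabs (t - x)).
  { intros s. unfold Rmin, Rmax. destruct (Rle_dec x t); unfold Rabs;
      destruct (Rcase_abs (s - x)); destruct (Rcase_abs (t - x)); lra. }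
  destruct (MVT_gen h x t dh) as (c & Hc & Heq).
  - intros s Hs. apply Hd. apply Rle_lt_trans with (2 := Ht). apply Hin. lra.
  - intros s Hs. apply continuity_pt_filterlim.
    apply (ex_derive_continuous h). eexists. apply Hd.
    apply Rle_lt_trans with (2 := Ht). now apply Hin.
  - rewrite H0, Rminus_0_r in Heq. rewrite Heq, Rabs_mult. simpl.
    pose proof (Hin c Hc) as Hct.
    replace (eps * (Rabs (t - x) * Rabs (t - x) ^ m))
      with (eps * Rabs (t - x) ^ m * Rabs (t - x)) by ring.
    apply Rmult_le_compat_r; [apply Rabs_pos|].
    eapply Rle_trans; [apply Hb; lra|].
    apply Rmult_le_compat_l; [assumption|]. apply pow_incr. split; [apply Rabs_pos|lra].
Qed.

(** In this expansion and the next two, [L] stands for the highest derivative at [x], and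
    the oscillation [eps] of that derivative takes the place of a derivative of one order
    more. *)
Lemma taylor_peano1 (g0 g1 : R -> R) (x delta eps L : R) :
  0 <= eps ->
  (forall t, Rabs (t - x) < delta -> is_derive g0 t (g1 t)) ->
  (forall t, Rabs (t - x) < delta -> Rabs (g1 t - L) <= eps) ->
  forall t, Rabs (t - x) < delta ->
  Rabs (g0 t - (g0 x + L * (t - x))) <= eps * Rabs (t - x) ^ 1.
Proof.
  intros Heps H0 H1.
  apply (integrate_bound (fun t => g0 t - (g0 x + L * (t - x))) (fun t => g1 t - L));
    [|ring| |assumption].
  - intros t Ht. apply (is_derive_minus g0 (fun t => g0 x + L * (t - x))); [now apply H0|].
    auto_derive; [auto|ring].
  - intros t Ht. rewrite Rmult_1_r. now apply H1.
Qed.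

Lemma taylor_peano2 (g0 g1 g2 : R -> R) (x delta eps L : R) :
  0 <= eps ->
  (forall t, Rabs (t - x) < delta -> is_derive g0 t (g1 t)) ->
  (forall t, Rabs (t - x) < delta -> is_derive g1 t (g2 t)) ->
  (forall t, Rabs (t - x) < delta -> Rabs (g2 t - L) <= eps) ->
  forall t, Rabs (t - x) < delta ->
  Rabs (g0 t - (g0 x + g1 x * (t - x) + L / 2 * (t - x) ^ 2)) <= eps * Rabs (t - x) ^ 2.
Proof.
  intros Heps H0 H1 H2.
  apply (integrate_bound (fun t => g0 t - (g0 x + g1 x * (t - x) + L / 2 * (t - x) ^ 2))
           (fun t => g1 t - (g1 x + L * (t - x)))); [|ring| |assumption].
  - intros t Ht. apply (is_derive_minus g0 (fun t => g0 x + g1 x * (t - x) + L / 2 * (t - x) ^ 2));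
      [now apply H0|]. auto_derive; [auto|field].
  - now apply (taylor_peano1 g1 g2).
Qed.

Lemma taylor_peano3 (g0 g1 g2 g3 : R -> R) (x delta eps L : R) :
  0 <= eps ->
  (forall t, Rabs (t - x) < delta -> is_derive g0 t (g1 t)) ->
  (forall t, Rabs (t - x) < delta -> is_derive g1 t (g2 t)) ->
  (forall t, Rabs (t - x) < delta -> is_derive g2 t (g3 t)) ->
  (forall t, Rabs (t - x) < delta -> Rabs (g3 t - L) <= eps) ->
  forall t, Rabs (t - x) < delta ->
  Rabs (g0 t - (g0 x + g1 x * (t - x) + g2 x / 2 * (t - x) ^ 2 + L / 6 * (t - x) ^ 3))
  <= eps * Rabs (t - x) ^ 3.
Proof.
  intros Heps H0 H1 H2 H3.
  apply (integrate_bound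
    (fun t => g0 t - (g0 x + g1 x * (t - x) + g2 x / 2 * (t - x) ^ 2 + L / 6 * (t - x) ^ 3))
    (fun t => g1 t - (g1 x + g2 x * (t - x) + L / 2 * (t - x) ^ 2))); [|field| |assumption].
  - intros t Ht. apply (is_derive_minus g0
      (fun t => g0 x + g1 x * (t - x) + g2 x / 2 * (t - x) ^ 2 + L / 6 * (t - x) ^ 3));
      [now apply H0|]. auto_derive; [auto|field].
  - now apply (taylor_peano2 g1 g2 g3).
Qed.

(** Zero above degree three, to fit the square range of [taylor_poly]. *)
Definition taylor_coef (D : nat -> nat -> R) (r s : nat) : R :=
  if (r + s <=? 3)%nat then D r s / (INR (fact r) * INR (fact s)) else 0.

Definition continuous2_at (F : R -> R -> R) (x y : R) : Prop :=
  forall eps, 0 < eps -> exists delta, 0 < delta /\ forall u v,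
    Rabs (u - x) < delta -> Rabs (v - y) < delta -> Rabs (F u v - F x y) <= eps.

Lemma mixed_cube_le (s t : R) : 0 <= s -> 0 <= t -> s ^ 2 * t <= s ^ 3 + t ^ 3.
Proof.
  intros Hs Ht. pose proof (pow_le s 3 Hs). pose proof (pow_le t 3 Ht).
  destruct (Rle_dec s t) as [H1 | H1].
  - assert (s ^ 2 <= t ^ 2) by (apply pow_incr; lra).
    assert (s ^ 2 * t <= t ^ 2 * t) by (apply Rmult_le_compat_r; lra). nra.
  - assert (s ^ 2 * t <= s ^ 2 * s) by (apply Rmult_le_compat_l; [nra|lra]). nra.
Qed.

(** The expansion is done in [v] at fixed [u], and then each coefficient [D 0 j u y] is
    expanded in [u]. This order produces exactly the mixed derivatives taken first in the
    second variable and then in the first. *)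
Lemma taylor_local (D : nat -> nat -> R -> R -> R) (x y rho : R) :
  0 < rho ->
  (forall j u v, (j <= 2)%nat -> Rabs (u - x) < rho -> Rabs (v - y) < rho ->
     is_derive (fun t => D 0%nat j u t) v (D 0%nat (S j) u v)) ->
  (forall s j u v, (s + j <= 2)%nat -> Rabs (u - x) < rho -> Rabs (v - y) < rho ->
     is_derive (fun t => D s j t v) u (D (S s) j u v)) ->
  (forall s j, (s + j = 3)%nat -> continuous2_at (D s j) x y) ->
  forall eps, 0 < eps -> exists delta, 0 < delta /\ forall u v,
    Rabs (u - x) < delta -> Rabs (v - y) < delta ->
    Rabs (D 0%nat 0%nat u v - taylor_poly (taylor_coef (fun r s => D r s x y)) x y u v)
    <= eps * (Rabs (u - x) ^ 3 + Rabs (v - y) ^ 3).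
Proof.
  intros Hrho HDy HDx Hcont eps Heps.
  set (e := eps / 4). assert (He : 0 < e) by (unfold e; lra).
  destruct (Hcont 0%nat 3%nat eq_refl e He) as (d0 & Hd0 & C0).
  destruct (Hcont 1%nat 2%nat eq_refl e He) as (d1 & Hd1 & C1).
  destruct (Hcont 2%nat 1%nat eq_refl e He) as (d2 & Hd2 & C2).
  destruct (Hcont 3%nat 0%nat eq_refl e He) as (d3 & Hd3 & C3).
  set (d := Rmin rho (Rmin (Rmin d0 d1) (Rmin d2 d3))).
  assert (Hd : 0 < d /\ d <= rho /\ d <= d0 /\ d <= d1 /\ d <= d2 /\ d <= d3).
  { unfold d, Rmin. repeat destruct Rle_dec; lra. }
  exists d. split; [lra|]. intros u v Hu Hv.
  assert (Hyy : Rabs (y - y) < d) by (rewrite Rminus_eq_0, Rabs_R0; lra).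
  assert (E0 := taylor_peano3 (D 0%nat 0%nat u) (D 0%nat 1%nat u) (D 0%nat 2%nat u) (D 0%nat 3%nat u)
    y d e (D 0%nat 3%nat x y) ltac:(lra)
    ltac:(intros; apply HDy; lia || lra) ltac:(intros; apply HDy; lia || lra)
    ltac:(intros; apply HDy; lia || lra) ltac:(intros; apply C0; lra) v Hv).
  assert (E1 := taylor_peano3 (fun t => D 0%nat 0%nat t y) (fun t => D 1%nat 0%nat t y)
    (fun t => D 2%nat 0%nat t y) (fun t => D 3%nat 0%nat t y)
    x d e (D 3%nat 0%nat x y) ltac:(lra)
    ltac:(intros; apply HDx; lia || lra) ltac:(intros; apply HDx; lia || lra)
    ltac:(intros; apply HDx; lia || lra) ltac:(intros; apply C3; lra) u Hu).
  assert (E2 := taylor_peano2 (fun t => D 0%nat 1%nat t y) (fun t => D 1%nat 1%nat t y)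
    (fun t => D 2%nat 1%nat t y)
    x d e (D 2%nat 1%nat x y) ltac:(lra)
    ltac:(intros; apply HDx; lia || lra) ltac:(intros; apply HDx; lia || lra)
    ltac:(intros; apply C2; lra) u Hu).
  assert (E3 := taylor_peano1 (fun t => D 0%nat 2%nat t y) (fun t => D 1%nat 2%nat t y)
    x d e (D 1%nat 2%nat x y) ltac:(lra)
    ltac:(intros; apply HDx; lia || lra)
    ltac:(intros; apply C1; lra) u Hu).
  cbv beta in E0, E1, E2, E3.
  match type of E0 with Rabs ?a <= _ => set (e0 := a) in * end.
  match type of E1 with Rabs ?a <= _ => set (e1 := a) in * end.
  match type of E2 with Rabs ?a <= _ => set (e2 := a) in * end.
  match type of E3 with Rabs ?a <= _ => set (e3 := a) in * end.
  replace (D 0%nat 0%nat u v - taylor_poly (taylor_coef (fun r s => D r s x y)) x y u v)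
    with (e0 + e1 + e2 * (v - y) + e3 / 2 * (v - y) ^ 2).
  2:{ unfold taylor_poly. rewrite !sum_Sn, !sum_O, !sum_Sn, !sum_O.
      unfold taylor_coef. simpl Nat.leb. cbv iota. unfold plus; simpl.
      unfold e0, e1, e2, e3. field. }
  set (h1 := Rabs (u - x)) in *. set (h2 := Rabs (v - y)) in *.
  assert (H1 : 0 <= h1) by apply Rabs_pos. assert (H2 : 0 <= h2) by apply Rabs_pos.
  assert (F2 : Rabs (e2 * (v - y)) <= e * h1 ^ 2 * h2).
  { rewrite Rabs_mult. now apply Rmult_le_compat_r. }
  assert (F3 : Rabs (e3 / 2 * (v - y) ^ 2) <= e * h1 * h2 ^ 2).
  { rewrite Rabs_mult, <- RPow_abs. fold h2. apply Rmult_le_compat_r; [nra|].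
    unfold Rdiv. rewrite Rabs_mult, (Rabs_pos_eq (/ 2)) by lra.
    pose proof (Rabs_pos e3). lra. }
  assert (M1 : h1 ^ 2 * h2 <= h1 ^ 3 + h2 ^ 3).
  { now apply mixed_cube_le. }
  assert (M2 : h1 * h2 ^ 2 <= h1 ^ 3 + h2 ^ 3).
  { rewrite Rmult_comm, Rplus_comm. now apply mixed_cube_le. }
  assert (M3 : 0 <= h1 ^ 3) by now apply pow_le.
  assert (M4 : 0 <= h2 ^ 3) by now apply pow_le.
  apply Rle_trans with (e * h2 ^ 3 + e * h1 ^ 3 + e * h1 ^ 2 * h2 + e * h1 * h2 ^ 2).
  - eapply Rle_trans; [apply Rabs_triang|].
    apply Rplus_le_compat; [|exact F3].
    eapply Rle_trans; [apply Rabs_triang|].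
    apply Rplus_le_compat; [|exact F2].
    eapply Rle_trans; [apply Rabs_triang|]. now apply Rplus_le_compat.
  - unfold e. nra.
Qed.

(** * The Taylor remainder on a cell *)

Lemma sum_n_abs_le (u v : nat -> R) (N : nat) :
  (forall k, (k <= N)%nat -> Rabs (u k) <= v k) -> Rabs (sum_n u N) <= sum_n v N.
Proof.
  intros H. induction N as [|N IH].
  - rewrite !sum_O. now apply H.
  - rewrite !sum_Sn. eapply Rle_trans; [apply Rabs_triang|].
    apply Rplus_le_compat; [apply IH; auto | apply H; lia].
Qed.

Lemma taylor_poly_abs_le (p : nat -> nat -> R) (x y : R) :
  exists B, 0 <= B /\ forall u v,
    Rabs (taylor_poly p x y u v)
    <= B * ((1 + Rabs (u - x)) * (1 + Rabs (v - y))) ^ 3.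
Proof.
  set (B := sum_n (fun r => sum_n (fun s => Rabs (p r s)) 3) 3).
  exists B. split.
  - eapply Rle_trans; [apply (Rabs_pos (sum_n (fun r => sum_n (fun s => Rabs (p r s)) 3) 3))|].
    apply sum_n_abs_le. intros r _. apply sum_n_abs_le. intros s _.
    rewrite Rabs_Rabsolu. apply Rle_refl.
  - intros u v. unfold taylor_poly, B.
    set (Q := ((1 + Rabs (u - x)) * (1 + Rabs (v - y))) ^ 3).
    rewrite <- (sum_n_mult_r (K := R_Ring)). apply sum_n_abs_le. intros r Hr.
    rewrite <- (sum_n_mult_r (K := R_Ring)). apply sum_n_abs_le. intros s Hs.
    rewrite !Rabs_mult, <- !RPow_abs. unfold mult; simpl.
    apply Rmult_le_compat_l; [apply Rabs_pos|]. unfold Q. rewrite Rpow_mult_distr.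
    pose proof (Rabs_pos (u - x)). pose proof (Rabs_pos (v - y)).
    assert (Hpow : forall h k, 0 <= h -> (k <= 3)%nat -> h ^ k <= (1 + h) ^ 3).
    { intros h k Hh Hk. apply Rle_trans with ((1 + h) ^ k).
      - apply pow_incr. lra.
      - apply Rle_pow; [lra|exact Hk]. }
    apply Rmult_le_compat; auto using pow_le.
Qed.

(** Away from [(x, y)] the quotient [(h1 + h2) / delta] is at least 1, so its fourth power
    turns the growth bound into a term of higher order than the third: it will carry an
    additional factor [1 / sqrt n]. *)
Lemma taylor_global (F : R -> R -> R) (p : nat -> nat -> R) (x y M : R) (q : nat) :
  0 <= M ->
  (forall u v, 0 <= u -> 0 <= v ->
     Rabs (F u v) <= M * ((1 + Rabs (u - x)) * (1 + Rabs (v - y))) ^ q) ->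
  (forall eps, 0 < eps -> exists delta, 0 < delta /\ forall u v,
     0 <= u -> 0 <= v -> Rabs (u - x) < delta -> Rabs (v - y) < delta ->
     Rabs (F u v - taylor_poly p x y u v)
     <= eps * (Rabs (u - x) ^ 3 + Rabs (v - y) ^ 3)) ->
  forall eps, 0 < eps -> exists C, 0 <= C /\ forall u v, 0 <= u -> 0 <= v ->
    Rabs (F u v - taylor_poly p x y u v)
    <= eps * (Rabs (u - x) ^ 3 + Rabs (v - y) ^ 3)
       + C * (Rabs (u - x) + Rabs (v - y)) ^ 4
         * ((1 + Rabs (u - x)) * (1 + Rabs (v - y))) ^ (q + 3).
Proof.
  intros HM Hgrowth Hlocal eps Heps.
  destruct (Hlocal eps Heps) as (delta & Hdelta & Hnear).
  destruct (taylor_poly_abs_le p x y) as (B & HB & HT).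
  set (C := (M + B) / delta ^ 4).
  assert (Hd4 : 0 < delta ^ 4) by now apply pow_lt.
  assert (HC : 0 <= C) by (apply Rdiv_le_0_compat; lra).
  exists C. split; [exact HC|]. intros u v Hu Hv.
  specialize (Hgrowth u v Hu Hv). specialize (HT u v). specialize (Hnear u v Hu Hv).
  set (h1 := Rabs (u - x)) in *. set (h2 := Rabs (v - y)) in *.
  assert (H1 : 0 <= h1) by apply Rabs_pos. assert (H2 : 0 <= h2) by apply Rabs_pos.
  set (Q := (1 + h1) * (1 + h2)) in *.
  assert (HQ : 1 <= Q) by (unfold Q; nra).
  assert (P1 : 0 <= h1 ^ 3) by now apply pow_le.
  assert (P2 : 0 <= h2 ^ 3) by now apply pow_le.
  assert (P3 : 0 <= (h1 + h2) ^ 4) by (apply pow_le; lra).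
  assert (PQ : 0 <= Q ^ (q + 3)) by (apply pow_le; lra).
  assert (Hcases : (h1 < delta /\ h2 < delta) \/ delta <= h1 + h2).
  { destruct (Rlt_dec h1 delta); [destruct (Rlt_dec h2 delta)|]; lra. }
  destruct Hcases as [[L1 L2] | Lfar].
  - apply Rle_trans with (1 := Hnear L1 L2).
    assert (0 <= C * (h1 + h2) ^ 4 * Q ^ (q + 3))
      by (apply Rmult_le_pos; [apply Rmult_le_pos|]; assumption). lra.
  - apply Rle_trans with (C * (h1 + h2) ^ 4 * Q ^ (q + 3)); [|nra].
    assert (Hfar : delta ^ 4 <= (h1 + h2) ^ 4) by (apply pow_incr; lra).
    apply Rle_trans with (M * Q ^ (q + 3) + B * Q ^ (q + 3)).
    + eapply Rle_trans; [apply Rabs_triang|]. rewrite Rabs_Ropp. apply Rplus_le_compat.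
      * eapply Rle_trans; [exact Hgrowth|]. apply Rmult_le_compat_l; [lra|].
        apply Rle_pow; [lra|lia].
      * eapply Rle_trans; [exact HT|]. apply Rmult_le_compat_l; [lra|].
        apply Rle_pow; [lra|lia].
    + rewrite <- Rmult_plus_distr_r. apply Rmult_le_compat_r; [lra|].
      replace (M + B) with (C * delta ^ 4) by (unfold C; field; lra).
      now apply Rmult_le_compat_l.
Qed.

Lemma cell_distance (a : R) (n k : nat) (x u : R) :
  (1 <= n)%nat -> INR k <= (INR n + 1) * u <= INR k + 1 -> 0 <= x ->
  Rabs (u - x) <= (dev a n x k + (Rabs (shift a x) + 1)) / sqrt (INR n).
Proof.
  intros Hn Hu Hx. pose proof (le_INR _ _ Hn) as HnR. simpl in HnR.
  pose proof (dev_nonneg a n x k Hn) as Hdev.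
  assert (Hs : 1 <= sqrt (INR n)) by (rewrite <- sqrt_1; apply sqrt_le_1_alt; lra).
  assert (Hsq : sqrt (INR n) * sqrt (INR n) = INR n) by (apply sqrt_sqrt; lra).
  assert (Hd : Rabs (INR k - mean a n x) = dev a n x k * sqrt (INR n))
    by (unfold dev; field; lra).
  set (c := Rabs (shift a x) + 1). assert (Hc : 0 <= c).
  { unfold c. pose proof (Rabs_pos (shift a x)). lra. }
  assert (HN : (INR n + 1) * Rabs (u - x) <= dev a n x k * sqrt (INR n) + c).
  { rewrite <- (Rabs_pos_eq (INR n + 1)), <- Rabs_mult by lra.
    replace ((INR n + 1) * (u - x))
      with (((INR n + 1) * u - INR k) + ((INR k - mean a n x) + shift a x))
      by (unfold mean, shift; field; lra).
    eapply Rle_trans; [apply Rabs_triang|].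
    assert (Rabs ((INR n + 1) * u - INR k) <= 1) by (apply Rabs_le; lra).
    pose proof (Rabs_triang (INR k - mean a n x) (shift a x)). unfold c. lra. }
  apply Rmult_le_reg_l with (INR n); [lra|].
  replace (INR n * ((dev a n x k + c) / sqrt (INR n)))
    with ((dev a n x k + c) * sqrt (INR n)) by (rewrite <- Hsq at 2; field; lra).
  pose proof (Rabs_pos (u - x)). nra.
Qed.

(** By [cell_distance], on a cell the distances to [(x, y)] are [1 / sqrt n] times an affine
    function of [dev]. The third-order term of [taylor_global] therefore contributes
    [eps * n^(-3/2)], and the fourth-order one [C * n^(-2)], each times a power of the
    deviations, which [pow_le_exp_half] replaces by exponentials. *)
Lemma cell_mean_remainder (F : R -> R -> R) (p : nat -> nat -> R) (a x y M : R) (q : nat) :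
  0 < x -> 0 < y -> 0 <= M -> (forall u v, continuity_2d_pt F u v) ->
  (forall u v, 0 <= u -> 0 <= v ->
     Rabs (F u v) <= M * ((1 + Rabs (u - x)) * (1 + Rabs (v - y))) ^ q) ->
  (forall eps, 0 < eps -> exists delta, 0 < delta /\ forall u v,
     0 <= u -> 0 <= v -> Rabs (u - x) < delta -> Rabs (v - y) < delta ->
     Rabs (F u v - taylor_poly p x y u v)
     <= eps * (Rabs (u - x) ^ 3 + Rabs (v - y) ^ 3)) ->
  forall eta, 0 < eta -> exists N, forall n, (N <= n)%nat -> (1 <= n)%nat -> forall i j,
    Rabs (cell_mean n F i j - taylor_cells p n x y i j)
    <= eta / (INR n * sqrt (INR n)) * (exp (dev a n x i / 2) * exp (dev a n y j / 2)).
Proof.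
  intros Hx Hy HM HF Hgrowth Hlocal eta Heta.
  set (q' := (q + 3 + 4)%nat).
  set (cx := Rabs (shift a x) + 1). set (cy := Rabs (shift a y) + 1).
  assert (Hcx : 0 <= cx) by (unfold cx; pose proof (Rabs_pos (shift a x)); lra).
  assert (Hcy : 0 <= cy) by (unfold cy; pose proof (Rabs_pos (shift a y)); lra).
  destruct (pow_le_exp_half cx q' Hcx) as (Cx & HCx & Ex).
  destruct (pow_le_exp_half cy q' Hcy) as (Cy & HCy & Ey).
  assert (HCC : 0 < Cx * Cy) by now apply Rmult_lt_0_compat.
  set (eps := eta / (4 * (Cx * Cy))).
  assert (Heps : 0 < eps) by (apply Rdiv_lt_0_compat; lra).
  destruct (taylor_global F p x y M q HM Hgrowth Hlocal eps Heps) as (C & HC & Hglob).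
  destruct (nfloor_ex ((C / (2 * eps)) ^ 2)) as [N [_ HN]]; [apply pow2_ge_0|].
  exists (S N). intros n Hn Hn1 i j.
  pose proof (le_INR _ _ Hn) as HnN. rewrite S_INR in HnN.
  pose proof (le_INR _ _ Hn1) as HnR. simpl in HnR.
  assert (Hs1 : 1 <= sqrt (INR n)) by (rewrite <- sqrt_1; apply sqrt_le_1_alt; lra).
  assert (Hsq : sqrt (INR n) * sqrt (INR n) = INR n) by (apply sqrt_sqrt; lra).
  set (w := / sqrt (INR n)).
  assert (Hw : 0 < w <= 1).
  { split; [apply Rinv_0_lt_compat; lra|]. rewrite <- Rinv_1. apply Rinv_le_contravar; lra. }
  assert (HCw : C * w <= 2 * eps).
  { assert (HCs : C / (2 * eps) <= sqrt (INR n)).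
    { rewrite <- (sqrt_pow2 (C / (2 * eps))) by (apply Rdiv_le_0_compat; lra).
      apply sqrt_le_1_alt. lra. }
    unfold w. apply Rmult_le_reg_r with (sqrt (INR n)); [lra|].
    rewrite Rmult_assoc, Rinv_l, Rmult_1_r by lra.
    apply Rmult_le_compat_l with (r := 2 * eps) in HCs; [|lra].
    replace (2 * eps * (C / (2 * eps))) with C in HCs by (field; lra). exact HCs. }
  assert (Hw3 : / (INR n * sqrt (INR n)) = w ^ 3).
  { unfold w. rewrite <- Hsq at 1. field. lra. }
  set (d1 := dev a n x i). set (d2 := dev a n y j).
  assert (Hd1 : 0 <= d1) by now apply dev_nonneg.
  assert (Hd2 : 0 <= d2) by now apply dev_nonneg.
  set (Q := (1 + cx + d1) * (1 + cy + d2)).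
  assert (HQ1 : 1 <= Q) by (unfold Q; nra).
  apply Rle_trans with (w ^ 3 * (4 * eps) * Q ^ q').
  - rewrite <- cell_mean_taylor.
    apply cell_mean_close; [exact HF | intros; apply taylor_poly_continuous |].
    intros u v Hu Hv.
    assert (Hu0 : 0 <= u) by (pose proof (pos_INR i); nra).
    assert (Hv0 : 0 <= v) by (pose proof (pos_INR j); nra).
    specialize (Hglob u v Hu0 Hv0).
    pose proof (cell_distance a n i x u Hn1 Hu (Rlt_le _ _ Hx)) as B1.
    pose proof (cell_distance a n j y v Hn1 Hv (Rlt_le _ _ Hy)) as B2.
    fold cx d1 in B1. fold cy d2 in B2. unfold Rdiv in B1, B2. fold w in B1, B2.
    set (h1 := Rabs (u - x)) in *. set (h2 := Rabs (v - y)) in *.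
    assert (H1 : 0 <= h1) by apply Rabs_pos. assert (H2 : 0 <= h2) by apply Rabs_pos.
    assert (G12 : h1 + h2 <= w * Q).
    { apply Rle_trans with (w * ((d1 + cx) + (d2 + cy))); [lra|].
      apply Rmult_le_compat_l; [lra|]. unfold Q. nra. }
    assert (GQ : (1 + h1) * (1 + h2) <= Q).
    { unfold Q. apply Rmult_le_compat; try lra; nra. }
    assert (Hcube : forall h, 0 <= h <= w * Q -> h ^ 3 <= w ^ 3 * Q ^ q').
    { intros h Hh. apply Rle_trans with ((w * Q) ^ 3); [now apply pow_incr|].
      rewrite Rpow_mult_distr. apply Rmult_le_compat_l; [apply pow_le; lra|].
      apply Rle_pow; [lra|unfold q'; lia]. }
    assert (Hquart : C * (h1 + h2) ^ 4 * ((1 + h1) * (1 + h2)) ^ (q + 3)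
                     <= w ^ 3 * (2 * eps) * Q ^ q').
    { apply Rle_trans with (C * (w * Q) ^ 4 * Q ^ (q + 3)).
      - apply Rmult_le_compat.
        + apply Rmult_le_pos; [lra|apply pow_le; lra].
        + apply pow_le. nra.
        + apply Rmult_le_compat_l; [lra|]. apply pow_incr. lra.
        + apply pow_incr. split; [nra|exact GQ].
      - replace (C * (w * Q) ^ 4 * Q ^ (q + 3)) with (w ^ 3 * (C * w) * Q ^ q').
        + apply Rmult_le_compat_r; [apply pow_le; lra|].
          apply Rmult_le_compat_l; [apply pow_le; lra|exact HCw].
        + unfold q'. rewrite (pow_add Q (q + 3)). ring. }
    pose proof (Hcube h1 ltac:(lra)) as K1. pose proof (Hcube h2 ltac:(lra)) as K2.
    eapply Rle_trans; [exact Hglob|].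
    apply Rmult_le_compat_l with (r := eps) in K1, K2; lra.
  - unfold Rdiv at 1. rewrite Hw3.
    apply Rle_trans with (w ^ 3 * (4 * eps) * ((Cx * exp (d1 / 2)) * (Cy * exp (d2 / 2)))).
    + apply Rmult_le_compat_l; [apply Rmult_le_pos; [apply pow_le|]; lra|].
      unfold Q. rewrite Rpow_mult_distr.
      apply Rmult_le_compat; auto; apply pow_le; lra.
    + right. unfold eps. field. lra.
Qed.

(** * From the quadrant to the plane *)

(** Continuity of [f] at the boundary of the quadrant is only one-sided, whereas the
    integrability criteria require two-sided continuity at the end points of the cells; the
    composition with the retraction onto the quadrant is continuous on the whole plane. *)
Definition clamp (f : R * R -> R) (u v : R) : R := f (Rmax 0 u, Rmax 0 v).

Lemma clamp_nonneg (f : R * R -> R) (u v : R) :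
  0 <= u -> 0 <= v -> clamp f u v = f (u, v).
Proof. intros Hu Hv. unfold clamp. now rewrite !Rmax_right. Qed.

Lemma continuous_on_quadrant (g : R * R -> R) (x y : R) :
  continuous_on quadrant g -> 0 <= x -> 0 <= y ->
  forall eps, 0 < eps -> exists delta, 0 < delta /\ forall u v,
    0 <= u -> 0 <= v -> Rabs (u - x) < delta -> Rabs (v - y) < delta ->
    Rabs (g (u, v) - g (x, y)) < eps.
Proof.
  intros Hg Hx Hy eps Heps.
  destruct (Hg (x, y) (conj Hx Hy) (ball (g (x, y)) eps)
              (locally_ball (g (x, y)) (mkposreal eps Heps))) as [delta Hd].
  exists delta. split; [apply cond_pos|]. intros u v Hu Hv Bu Bv.
  apply (Hd (u, v)); [split; assumption | split; assumption].
Qed.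

Lemma clamp_continuous (f : R * R -> R) (x y : R) :
  continuous_on quadrant f -> continuity_2d_pt (clamp f) x y.
Proof.
  intros Hf eps.
  destruct (continuous_on_quadrant f (Rmax 0 x) (Rmax 0 y) Hf (Rmax_l _ _) (Rmax_l _ _)
              eps (cond_pos eps)) as (delta & Hdelta & Hd).
  exists (mkposreal delta Hdelta). intros u v Hu Hv. simpl in Hu, Hv.
  assert (Hlip : forall s t, Rabs (Rmax 0 s - Rmax 0 t) <= Rabs (s - t)).
  { intros s t. unfold Rmax, Rabs. repeat destruct Rle_dec; repeat destruct Rcase_abs; lra. }
  apply Hd; try apply Rmax_l; eapply Rle_lt_trans; eauto.
Qed.

(** * Functions of the weighted class *)

Lemma is_derive_of_nonneg (g : R -> R) (x l : R) :
  0 < x -> is_derive_nonneg g x l -> is_derive g x l.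
Proof.
  intros Hx Hg. apply is_derive_Reals. intros eps Heps.
  destruct (Hg (ball l eps) (locally_ball l (mkposreal eps Heps))) as [delta Hd].
  assert (Hm : 0 < Rmin delta x) by (apply Rmin_pos; [apply cond_pos|exact Hx]).
  exists (mkposreal _ Hm). intros h Hh0 Hh. simpl in Hh.
  pose proof (Rmin_l delta x). pose proof (Rmin_r delta x).
  apply (Hd h); [|exact Hh0|].
  - change (Rabs (h - 0) < delta). rewrite Rminus_0_r. lra.
  - apply Rabs_lt_between in Hh. lra.
Qed.

(** At an interior point the one-sided restriction on the increments is void near 0, so
    that the derivative is unique and the definite description denotes it. *)
Lemma Derive_nonneg_correct (g : R -> R) (x : R) :
  0 < x -> ex_derive_nonneg g x -> is_derive g x (Derive_nonneg g x).
Proof.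
  intros Hx [l Hl]. apply is_derive_of_nonneg; [exact Hx|].
  unfold Derive_nonneg.
  apply (iota_correct (V := R_CompleteNormedModule) (fun l => is_derive_nonneg g x l)).
  exists l. split; [exact Hl|]. intros l' Hl'.
  apply is_derive_of_nonneg, is_derive_unique in Hl; [|exact Hx].
  apply is_derive_of_nonneg, is_derive_unique in Hl'; [|exact Hx]. congruence.
Qed.

Lemma partial_Dx (g1 g2 : nat) (f : R * R -> R) (s j : nat) (u v : R) :
  Cm_weighted 3 g1 g2 f -> (s + j <= 2)%nat -> 0 < u -> 0 < v ->
  is_derive (fun t => partial s j f (t, v)) u (partial (S s) j f (u, v)).
Proof.
  intros [_ Hf] Hsj Hu Hv.
  destruct (Hf (S s + j)%nat (S s)) as [[_ Hx] _]; [lia|lia|].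
  replace (S s + j - S s)%nat with j in Hx by lia.
  apply (Derive_nonneg_correct (fun t => partial s j f (t, v))); [exact Hu|].
  apply (Hx s ltac:(lia) (u, v)). split; simpl; lra.
Qed.

Lemma partial_Dy (g1 g2 : nat) (f : R * R -> R) (j : nat) (u v : R) :
  Cm_weighted 3 g1 g2 f -> (j <= 2)%nat -> 0 < u -> 0 < v ->
  is_derive (fun t => partial 0 j f (u, t)) v (partial 0 (S j) f (u, v)).
Proof.
  intros [_ Hf] Hj Hu Hv.
  destruct (Hf (S j) 0%nat) as [[Hy _] _]; [lia|lia|].
  apply (Derive_nonneg_correct (fun t => partial 0 j f (u, t))); [exact Hv|].
  apply (Hy j ltac:(lia) (u, v)). split; simpl; lra.
Qed.

Lemma partial_continuous (g1 g2 : nat) (f : R * R -> R) (s j : nat) :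
  Cm_weighted 3 g1 g2 f -> (1 <= s + j <= 3)%nat -> continuous_on quadrant (partial s j f).
Proof.
  intros [_ Hf] Hsj. destruct (Hf (s + j)%nat s) as [_ [H _]]; [lia|lia|].
  now replace (s + j - s)%nat with j in H by lia.
Qed.

Lemma weighted_growth (g1 g2 : nat) (f : R * R -> R) :
  C_weighted g1 g2 f -> exists M, 0 <= M /\ forall u v, 0 <= u -> 0 <= v ->
    Rabs (f (u, v)) <= M * ((1 + u ^ g1) * (1 + v ^ g2)).
Proof.
  intros (_ & [M HM] & _). exists (Rabs M). split; [apply Rabs_pos|]. intros u v Hu Hv.
  specialize (HM (u, v) (conj Hu Hv)). unfold omega2, omega in HM; simpl in HM.
  pose proof (pow_le u g1 Hu). pose proof (pow_le v g2 Hv).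
  assert (Hw : 0 < (1 + u ^ g1) * (1 + v ^ g2)) by nra.
  replace (f (u, v)) with ((1 + u ^ g1) * (1 + v ^ g2)
     * (/ (1 + u ^ g1) * / (1 + v ^ g2) * f (u, v))) by (field; lra).
  rewrite Rabs_mult, (Rabs_pos_eq _ (Rlt_le _ _ Hw)), Rmult_comm.
  apply Rmult_le_compat_r; [lra|]. eapply Rle_trans; [exact HM | apply Rle_abs].
Qed.

Lemma one_plus_pow_le (x u : R) (g : nat) :
  0 <= x -> 0 <= u -> 1 + u ^ g <= 2 * (1 + x) ^ g * (1 + Rabs (u - x)) ^ g.
Proof.
  intros Hx Hu. rewrite Rmult_assoc, <- Rpow_mult_distr.
  assert (Hle : 1 + u <= (1 + x) * (1 + Rabs (u - x))).
  { pose proof (Rle_abs (u - x)). pose proof (Rabs_pos (u - x)). nra. }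
  set (b := (1 + x) * (1 + Rabs (u - x))) in *.
  assert (H1 : 1 <= b ^ g) by (apply pow_R1_Rle; lra).
  assert (H2 : u ^ g <= b ^ g) by (apply pow_incr; lra). lra.
Qed.

Lemma growth_centered (f : R * R -> R) (g1 g2 : nat) (x y M : R) :
  0 <= x -> 0 <= y -> 0 <= M ->
  (forall u v, 0 <= u -> 0 <= v -> Rabs (f (u, v)) <= M * ((1 + u ^ g1) * (1 + v ^ g2))) ->
  exists M', 0 <= M' /\ forall u v, 0 <= u -> 0 <= v ->
    Rabs (clamp f u v) <= M' * ((1 + Rabs (u - x)) * (1 + Rabs (v - y))) ^ (g1 + g2).
Proof.
  intros Hx Hy HM Hf.
  exists (M * ((2 * (1 + x) ^ g1) * (2 * (1 + y) ^ g2))).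
  assert (Px : 0 <= 2 * (1 + x) ^ g1) by (apply Rmult_le_pos; [lra|apply pow_le; lra]).
  assert (Py : 0 <= 2 * (1 + y) ^ g2) by (apply Rmult_le_pos; [lra|apply pow_le; lra]).
  split; [apply Rmult_le_pos; [|apply Rmult_le_pos]; assumption|].
  intros u v Hu Hv. rewrite clamp_nonneg by assumption.
  eapply Rle_trans; [now apply Hf|]. rewrite Rmult_assoc. apply Rmult_le_compat_l; [exact HM|].
  pose proof (Rabs_pos (u - x)). pose proof (Rabs_pos (v - y)).
  pose proof (pow_le u g1 Hu). pose proof (pow_le v g2 Hv).
  apply Rle_trans with ((2 * (1 + x) ^ g1 * (1 + Rabs (u - x)) ^ (g1 + g2))
                        * (2 * (1 + y) ^ g2 * (1 + Rabs (v - y)) ^ (g1 + g2))).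
  - apply Rmult_le_compat; try lra.
    + eapply Rle_trans; [now apply one_plus_pow_le with (x := x)|].
      apply Rmult_le_compat_l; [exact Px|]. apply Rle_pow; [lra|lia].
    + eapply Rle_trans; [now apply one_plus_pow_le with (x := y)|].
      apply Rmult_le_compat_l; [exact Py|]. apply Rle_pow; [lra|lia].
  - rewrite Rpow_mult_distr. right. ring.
Qed.

Lemma subexp2_cell_mean (f : R * R -> R) (g1 g2 : nat) (M : R) (n : nat) :
  continuous_on quadrant f -> 0 <= M ->
  (forall u v, 0 <= u -> 0 <= v -> Rabs (f (u, v)) <= M * ((1 + u ^ g1) * (1 + v ^ g2))) ->
  subexp2 (cell_mean n (clamp f)).
Proof.
  intros Hc HM Hf.
  exists (fun i => M * (1 + (INR i + 1) ^ g1)), (fun j => 1 + (INR j + 1) ^ g2).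
  repeat split; auto 10 with subexp. intros i j.
  pose proof (pos_INR i). pose proof (pos_INR j). pose proof (pos_INR n).
  assert (Pi : 0 <= (INR i + 1) ^ g1) by (apply pow_le; lra).
  assert (Pj : 0 <= (INR j + 1) ^ g2) by (apply pow_le; lra).
  rewrite (Rabs_pos_eq (M * _)), (Rabs_pos_eq (1 + _)) by nra.
  assert (Hzero : cell_mean n (fun _ _ => 0) i j = 0).
  { unfold cell_mean, box_int.
    rewrite (RInt_ext _ (fun _ => 0)).
    - rewrite RInt_const. unfold scal; simpl; unfold mult; simpl. ring.
    - intros v _. rewrite RInt_const. unfold scal; simpl; unfold mult; simpl. ring. }
  rewrite <- (Rminus_0_r (cell_mean n (clamp f) i j)), <- Hzero.
  apply cell_mean_close.
  - intros. now apply clamp_continuous.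
  - intros. apply continuity_2d_pt_const.
  - intros u v Hu Hv. rewrite Rminus_0_r.
    assert (Hu0 : 0 <= u) by nra. assert (Hv0 : 0 <= v) by nra.
    rewrite clamp_nonneg by assumption. eapply Rle_trans; [now apply Hf|].
    rewrite Rmult_assoc. apply Rmult_le_compat_l; [exact HM|].
    assert (u ^ g1 <= (INR i + 1) ^ g1) by (apply pow_incr; nra).
    assert (v ^ g2 <= (INR j + 1) ^ g2) by (apply pow_incr; nra).
    pose proof (pow_le u g1 Hu0). pose proof (pow_le v g2 Hv0).
    apply Rmult_le_compat; lra.
Qed.

Lemma K_expect2 (a : R) (n : nat) (f : R * R -> R) (x y : R) :
  K a n n f x y = expect2 a n x y (cell_mean n (clamp f)).
Proof.
  unfold K, expect2, expect. rewrite <- Series_scal_l. apply Series_ext. intros i.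
  rewrite <- !Series_scal_l. apply Series_ext. intros j. unfold W2, cell_mean, box_int.
  assert (Hcell : forall k t, Rmin (INR k / (INR n + 1)) ((INR k + 1) / (INR n + 1)) < t ->
            0 <= t).
  { intros k t Ht. pose proof (pos_INR k). pose proof (pos_INR n).
    assert (0 <= INR k / (INR n + 1)) by (apply Rdiv_le_0_compat; lra).
    assert (0 <= (INR k + 1) / (INR n + 1)) by (apply Rdiv_le_0_compat; lra).
    unfold Rmin in Ht. destruct Rle_dec in Ht; lra. }
  rewrite (RInt_ext (fun v => RInt (fun u => f (u, v)) _ _)
     (fun v => RInt (fun u => clamp f u v)
                (INR i / (INR n + 1)) ((INR i + 1) / (INR n + 1)))).
  - ring.
  - intros v [Hv _]. apply RInt_ext. intros u [Hu _].
    symmetry. apply clamp_nonneg; eauto.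
Qed.

Lemma taylor_cells_flip (p : nat -> nat -> R) (n : nat) (x y : R) (i j : nat) :
  taylor_cells (fun r s => p s r) n y x j i = taylor_cells p n x y i j.
Proof.
  unfold taylor_cells. rewrite sum_n_switch.
  apply sum_n_ext. intros r. apply sum_n_ext. intros s.
  rewrite (Rmult_comm (cell_moment n y s j)). reflexivity.
Qed.

Lemma taylor_coef_high (D : nat -> nat -> R) (r s : nat) :
  (3 < r + s)%nat -> taylor_coef D r s = 0.
Proof.
  intros H. unfold taylor_coef. destruct (Nat.leb_spec (r + s) 3); [lia|reflexivity].
Qed.

Theorem theorem7 (a : R) (g1 g2 : nat) (f : R * R -> R)
  (ha : 0 <= a) (hf : Cm_weighted 3 g1 g2 f)
  (x y : R) (hx : 0 < x) (hy : 0 < y) :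
  ((forall n : nat, (1 <= n)%nat -> ex_derive (fun w => K a n n f w y) x) /\
   is_lim_seq
     (fun n => INR n * (Derive (fun w => K a n n f w y) x - partial 1 0 f (x, y)))
     (Finite
       ((- 1 + a / (1 + x) ^ 2) * partial 1 0 f (x, y)
        + (1 + a * x / (1 + x)) * partial 2 0 f (x, y)
        + (- y + a * y / (1 + y) + 1 / 2) * partial 1 1 f (x, y)
        + y / 2 * (1 + y) * partial 1 2 f (x, y)
        + x / 2 * (1 + x) * partial 3 0 f (x, y)))) /\
  ((forall n : nat, (1 <= n)%nat -> ex_derive (fun v => K a n n f x v) y) /\
   is_lim_seq
     (fun n => INR n * (Derive (fun v => K a n n f x v) y - partial 0 1 f (x, y)))
     (Finite
       ((- 1 + a / (1 + y) ^ 2) * partial 0 1 f (x, y)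
        + (1 + a * y / (1 + y)) * partial 0 2 f (x, y)
        + (- x + a * x / (1 + x) + 1 / 2) * partial 1 1 f (x, y)
        + x / 2 * (1 + x) * partial 2 1 f (x, y)
        + y / 2 * (1 + y) * partial 0 3 f (x, y)))).
Proof.
  set (p := taylor_coef (fun r s => partial r s f (x, y))).
  set (c := fun n => cell_mean n (clamp f)).
  assert (Hcont : continuous_on quadrant f) by apply hf.
  destruct (weighted_growth g1 g2 f (proj1 hf)) as (M & HM & Hgrowth).
  assert (Hc : forall n, subexp2 (c n)) by (intros n; eapply subexp2_cell_mean; eauto).
  assert (Hrem : forall eta, 0 < eta -> exists N, forall n, (N <= n)%nat -> (1 <= n)%nat ->
     forall i j, Rabs (c n i j - taylor_cells p n x y i j)
     <= eta / (INR n * sqrt (INR n)) * (exp (dev a n x i / 2) * exp (dev a n y j / 2))).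
  { destruct (growth_centered f g1 g2 x y M (Rlt_le _ _ hx) (Rlt_le _ _ hy) HM Hgrowth)
      as (M' & HM' & Hg').
    apply (cell_mean_remainder (clamp f) p a x y M' (g1 + g2)); auto.
    { intros. now apply clamp_continuous. }
    intros eps Heps.
    destruct (taylor_local (fun s j u v => partial s j f (u, v)) x y (Rmin x y)) with eps
      as (delta & Hdelta & Hd); auto.
    - now apply Rmin_pos.
    - intros j u v Hj Hu Hv. pose proof (Rmin_l x y). pose proof (Rmin_r x y).
      apply Rabs_lt_between in Hu, Hv. apply (partial_Dy g1 g2); auto; lra.
    - intros s j u v Hj Hu Hv. pose proof (Rmin_l x y). pose proof (Rmin_r x y).
      apply Rabs_lt_between in Hu, Hv. apply (partial_Dx g1 g2); auto; lra.
    - intros s j Hsj e He.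
      assert (Hp : continuous_on quadrant (partial s j f))
        by (apply (partial_continuous g1 g2); auto; lia).
      destruct (continuous_on_quadrant _ x y Hp (Rlt_le _ _ hx) (Rlt_le _ _ hy) e He)
        as (d & Hd0 & Hd).
      exists (Rmin d (Rmin x y)). split; [repeat apply Rmin_pos; auto|].
      intros u v Hu Hv. pose proof (Rmin_l x y). pose proof (Rmin_r x y).
      pose proof (Rmin_l d (Rmin x y)). pose proof (Rmin_r d (Rmin x y)).
      left. apply Hd; try lra.
      + apply Rabs_lt_between in Hu. lra.
      + apply Rabs_lt_between in Hv. lra.
    - exists delta. split; [exact Hdelta|]. intros u v Hu Hv Bu Bv.
      rewrite clamp_nonneg by assumption. now apply Hd. }
  assert (Hp : forall r s, (3 < r + s)%nat -> p r s = 0)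
    by (intros; now apply taylor_coef_high).
  split; split.
  - intros n _. apply ex_derive_ext with (fun w => expect2 a n w y (c n)).
    { intros w. symmetry. apply K_expect2. }
    eexists. apply is_derive_expect2; auto; lra.
  - pose proof (derivative_limit a x y p c ha hx hy Hp Hc Hrem) as H.
    match type of H with is_lim_seq _ (Finite ?L) =>
      match goal with |- is_lim_seq _ (Finite ?L') => replace L' with L end end.
    2:{ unfold p, taylor_coef, shift. simpl. field. lra. }
    revert H. apply is_lim_seq_ext. intros n.
    rewrite (Derive_ext (fun w => K a n n f w y) (fun w => expect2 a n w y (c n)))
      by (intros; apply K_expect2).
    unfold p, taylor_coef. simpl Nat.leb. cbv iota. simpl fact. simpl INR.
    f_equal. f_equal. field.
  - intros n _.
    (* [expect2_flip] needs [0 <= v], hence the equality only near [y]. *)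
    apply ex_derive_ext_loc with (fun v => expect2 a n v x (fun j i => c n i j)).
    { exists (mkposreal y hy). intros v Hv. rewrite K_expect2. symmetry.
      apply expect2_flip; try lra; [|apply Hc].
      change (Rabs (v - y) < y) in Hv. apply Rabs_lt_between in Hv. lra. }
    eexists. apply is_derive_expect2; auto using subexp2_flip; lra.
  - assert (Hrem' : forall eta, 0 < eta -> exists N, forall n, (N <= n)%nat -> (1 <= n)%nat ->
     forall j i, Rabs (c n i j - taylor_cells (fun r s => p s r) n y x j i)
     <= eta / (INR n * sqrt (INR n)) * (exp (dev a n y j / 2) * exp (dev a n x i / 2))).
    { intros eta Heta. destruct (Hrem eta Heta) as [N HN]. exists N.
      intros n Hn Hn1 j i. rewrite taylor_cells_flip, (Rmult_comm (exp _)). now apply HN. }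
    pose proof (derivative_limit a y x (fun r s => p s r) (fun n j i => c n i j) ha hy hx
      (fun r s h => Hp s r ltac:(lia)) (fun n => subexp2_flip _ (Hc n)) Hrem') as H.
    match type of H with is_lim_seq _ (Finite ?L) =>
      match goal with |- is_lim_seq _ (Finite ?L') => replace L' with L end end.
    2:{ unfold p, taylor_coef, shift. simpl. field. lra. }
    revert H. apply is_lim_seq_ext. intros n.
    rewrite (Derive_ext_loc (fun v => K a n n f x v)
               (fun v => expect2 a n v x (fun j i => c n i j))).
    2:{ exists (mkposreal y hy). intros v Hv. rewrite K_expect2.
        apply expect2_flip; try lra; [|apply Hc].
        change (Rabs (v - y) < y) in Hv. apply Rabs_lt_between in Hv. lra. }
    unfold p, taylor_coef. simpl Nat.leb. cbv iota. simpl fact. simpl INR.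
    f_equal. f_equal. field.
Qed.
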